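(* Let $p\geq 2$ and let $Y=\theta+\xi$, where $\theta\in\mathbb{R}^p$ is a constant (unknown) vector and $\xi$ is a random vector which, conditionally on a fixed $\sigma$-algebra $\mathcal{G}$, is Gaussian: $\mathrm{Law}(\xi\mid\mathcal{G})=\mathcal{N}_p(0,\mathcal{D}(\mathcal{G}))$, with $\mathcal{D}(\mathcal{G})$ a $\mathcal{G}$-measurable random positive definite $p\times p$ covariance matrix. Let $\Theta\subset\mathbb{R}^p$ be a compact set and assume: (i) there is a constant $\lambda_*>0$ such that $\lambda_{\min}(\mathcal{D}(\mathcal{G}))\geq\lambda_*$ almost surely; (ii) $\sup_{\theta\in\Theta}\mathbf{E}_\theta\,\lambda_{\max}(\mathcal{D}(\mathcal{G}))\leq a^*$ for some known constant $a^*>0$. Let $\gamma_p$ be the constant defined in the context, and consider the estimator $\theta^*=\left(1-\frac{c}{\|Y\|}\right)Y$ with $c=(p-1)\lambda_*\gamma_p$. Then $\theta^*$ dominates the maximum likelihood estimator $\hat\theta_{ML}=Y$ on $\Theta$, namely $$\sup_{\theta\in\Theta}\Delta(\theta)\leq-\big[(p-1)\lambda_*\gamma_p\big]^2,\qquad \Delta(\theta):=\mathbf{E}_\theta\|\theta^*-\theta\|^2-\mathbf{E}_\theta\|\hat\theta_{ML}-\theta\|^2 .$$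
   Context: $\mathbf{E}_\theta$ denotes expectation when the true parameter is $\theta$; $\lambda_{\min}(A),\lambda_{\max}(A)$ are the smallest and largest eigenvalues of a symmetric matrix $A$. Set $d=\sup\{\|\theta\|:\theta\in\Theta\}$ (the definition below requires $d>0$), $\mu=d/\sqrt{a^*}$, $I(a)=\int_0^\infty\frac{e^{-r^2/2}}{a+r}\,dr$, and $$\gamma_p=\frac{\sum_{j=0}^{p-2}2^{\frac{j-1}{2}}(-1)^{p-j}\mu^{p-1-j}\Gamma\!\left(\frac{j+1}{2}\right)-(-\mu)^pI(\mu)}{2^{p/2-1}\Gamma\!\left(\frac p2\right)d}.$$ *)

(* Defs.v *)
From HB Require Import structures.
From mathcomp Require Import all_boot all_order all_algebra.
From mathcomp Require Import all_classical all_reals all_analysis.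
Set Implicit Arguments. Unset Strict Implicit. Unset Printing Implicit Defensive.
Import Order.TTheory GRing.Theory Num.Theory.
Import numFieldNormedType.Exports.
Local Open Scope classical_set_scope.
Local Open Scope ring_scope.

Section defs.
Variable R : realType.

Definition norm2 (p : nat) (v : 'rV[R]_p) : R := Num.sqrt (\sum_(i < p) v 0 i ^+ 2).

Definition inner (p : nat) (u v : 'rV[R]_p) : R := \sum_(i < p) u 0 i * v 0 i.
Definition qform (p : nat) (A : 'M[R]_p) (t : 'rV[R]_p) : R := (t *m A *m t^T) 0 0.

Definition posdef (p : nat) (A : 'M[R]_p) : Prop :=
  A^T = A /\ forall v : 'rV[R]_p, v != 0 -> 0 < qform A v.

Definition lambda_min (p : nat) (A : 'M[R]_p) : R := inf [set a : R | eigenvalue A a].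
Definition lambda_max (p : nat) (A : 'M[R]_p) : R := sup [set a : R | eigenvalue A a].

Definition Gamma (x : R) : R :=
  Rintegral lebesgue_measure `]0, +oo[%classic (fun t => t `^ (x - 1) * expR (- t)).

Definition Ifun (a : R) : R :=
  Rintegral lebesgue_measure `[0, +oo[%classic (fun r => expR (- (r ^+ 2) / 2) / (a + r)).

(* gamma_p, with d = sup ||theta|| and mu = d / sqrt(a^* ) *)
Definition gamma_const (p : nat) (d astar : R) : R :=
  let mu := d / Num.sqrt astar in
  (\sum_(0 <= j < p.-1)
      2 `^ ((j%:R - 1) / 2) * (-1) ^+ (p - j) * mu ^+ (p - 1 - j) * Gamma ((j%:R + 1) / 2)
   - (- mu) ^+ p * Ifun mu)
  / (2 `^ (p%:R / 2 - 1) * Gamma (p%:R / 2) * d).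

End defs.

(* Main.v *)
(** Write [N] for the standard normal law, [G] for the standard Gaussian vector,
    [C = E|N|] and [s = sqrt lam_star].

    Since [C ||y|| = E |<G, y>|], expectations of Euclidean norms reduce to
    one-dimensional projections, which is all that the Cramer-Wold form of the
    hypothesis describes.  In dimension one [E|m + sigma N| = E max(|m|, sigma |N|)],
    and [max(a, x) - max(a, k x)] is nondecreasing in [x >= 0] for [0 <= k <= 1].
    Hence replacing the conditional covariance, which is at least [lam_star Id],
    by [lam_star Id] itself can only decrease the growth [E||theta + xi|| - E||theta + k xi||].

    For the Gaussian vector [theta + s G] this growth is estimated from below by
    Stein's identity applied to [y / sqrt(||y||^2 + eps)], with [eps] tending to [0]; it is
    at least [(1 - k) k (p - 1) lam_star E (1 / (d + s ||G||))].  By convexity,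
    [||theta + k xi|| >= ||Y|| - (1 - k) <xi, Y> / ||Y||], so letting [k] tend to [1] gives
    [E (<xi, Y> / ||Y||) >= (p - 1) lam_star E (1 / (d + sqrt astar ||G||)) = c], where
    the last expectation is identified with [gamma_p] through the density of [||G||] and
    the recursion [J (n+1) + mu J n = M n] for
    [J n = int r^n e^(-r^2/2) / (mu + r)] and [M n = int r^n e^(-r^2/2)].
    Expanding the square, the risk difference is at most
    [c^2 - 2 c E (<xi, Y> / ||Y||) <= - c^2]. *)

Require Import Defs.
From HB Require Import structures.
From mathcomp Require Import all_boot all_order all_algebra.
From mathcomp Require Import all_classical all_reals all_analysis.
From mathcomp Require Import measurable_realfun ring lra.
Import Order.TTheory GRing.Theory Num.Theory.
Import numFieldNormedType.Exports.
Local Open Scope classical_set_scope.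
Local Open Scope ring_scope.

(** Formally, E (<xi, Y> / ||Y||) is the derivative at k = 1 of E||theta + k xi||. Convexity bounds
    it below by every difference quotient with k < 1, so nothing is differentiated under the
    integral sign, and such increments are exactly what the comparison of covariances controls. The
    random covariance is thus removed before Stein's identity is used, and that identity is needed
    only for independent standard coordinates, one at a time.

    Where possible integrands are kept nonnegative, so that Tonelli and monotone convergence apply
    without integrability: inequalities between increments are written with sums on both sides, and
    Stein's identity carries an extra term |z| that makes its integrand nonnegative.

    Assumption (ii) enters through lam_star <= E lambda_max <= astar: replacing sqrt lam_star by
    sqrt astar in 1 / (d + s ||G||) then only lowers the bound. *)

Section density.
Local Open Scope ereal_scope.
Context d (T : measurableType d) (R : realType).
Variables (mu nu : {measure set T -> \bar R}) (g : T -> R).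
Hypothesis mg : measurable_fun setT g.
Hypothesis g0 : forall x, (0 <= g x)%R.
Hypothesis nuE : forall A, measurable A -> nu A = \int[mu]_(x in A) (g x)%:E.

Import HBNNSimple.

Let mgE : measurable_fun setT (EFin \o g).
Proof. exact/measurable_EFinP. Qed.

Let density_indic (A : set T) : measurable A ->
  \int[nu]_x (\1_A x)%:E = \int[mu]_x ((\1_A x)%:E * (g x)%:E).
Proof.
move=> mA; rewrite integral_indic// setIT nuE// integral_mkcond.
apply: eq_integral => x _; rewrite patchE indicE.
by case: (x \in A); rewrite ?mul1e ?mul0e.
Qed.

Let density_nnsfun (f : {nnsfun T >-> R}) :
  \int[nu]_x (f x)%:E = \int[mu]_x ((f x)%:E * (g x)%:E).
Proof.
under [LHS]eq_integral do rewrite fimfunE -fsumEFin//.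
rewrite [LHS]ge0_integral_fsum//; last 2 first.
  - by move=> r; exact/measurable_EFinP/measurableT_comp.
  - by move=> n x _; rewrite EFinM nnfun_muleindic_ge0.
under [RHS]eq_integral.
  move=> x xD; rewrite fimfunE -fsumEFin// ge0_mule_fsuml; last first.
    by move=> r; rewrite EFinM nnfun_muleindic_ge0.
  over.
rewrite [RHS]ge0_integral_fsum//; last 2 first.
  - move=> r; apply: emeasurable_funM; last exact: mgE.
    by apply/measurable_EFinP/measurableT_comp.
  - by move=> n x _; rewrite EFinM mule_ge0 ?nnfun_muleindic_ge0// lee_fin.
apply: eq_fsbigr => r _.
rewrite integralZl_indic_nnsfun//= density_indic//.
have [r0|r0] := leP 0%R r.
  rewrite -ge0_integralZl//.
  - by apply: eq_integral => x _; rewrite EFinM muleA.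
  - by apply: emeasurable_funM; [exact/measurable_EFinP|exact: mgE].
  - by move=> x _; rewrite mule_ge0// lee_fin.
have Z x : (\1_(f @^-1` [set r]) x)%R = 0%R :> R.
  rewrite indicE memNset//= => fxr.
  have : (0 <= f x)%R by [].
  by rewrite fxr leNgt r0.
rewrite integral0_eq ?mule0; last by move=> x _; rewrite Z mul0e.
by rewrite integral0_eq// => x _; rewrite Z mulr0 mul0e.
Qed.

(** Indicators are covered by [nuE], simple functions by additivity, and the general case by
    monotone convergence; infinite values of [f] and of the integral are allowed. *)
Lemma ge0_integral_density (f : T -> \bar R) :
  measurable_fun setT f -> (forall x, 0 <= f x) ->
  \int[nu]_x f x = \int[mu]_x (f x * (g x)%:E).
Proof.
move=> mf f0; pose f_ := nnsfun_approx measurableT mf.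
transitivity (limn (fun n => \int[nu]_x (f_ n x)%:E)).
  rewrite -monotone_convergence//=.
  - apply: eq_integral => ? /[!inE] xD; apply/esym/cvg_lim => //=.
    exact: cvg_nnsfun_approx.
  - by move=> n; exact/measurable_EFinP/measurable_funTS.
  - by move=> n ? _; rewrite lee_fin.
  - by move=> ? _ ? ? mn; rewrite lee_fin; exact/lefP/nd_nnsfun_approx.
under eq_fun do rewrite density_nnsfun.
rewrite -monotone_convergence//=.
- apply: eq_integral => x /[!inE] xD.
  under eq_fun do rewrite muleC.
  rewrite limeMl//; last by apply/cvg_ex; exists (f x); exact: cvg_nnsfun_approx.
  by rewrite muleC; congr (_ * _); apply/cvg_lim => //; exact: cvg_nnsfun_approx.
- move=> n; apply: emeasurable_funM; last exact: mgE.
  exact/measurable_EFinP/measurable_funTS.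
- by move=> n ? _; rewrite mule_ge0// lee_fin.
- move=> x _ ? ? mn; rewrite lee_wpmul2r// lee_fin//.
  exact/lefP/nd_nnsfun_approx.
Qed.

End density.

(** * Affine changes of variable for Lebesgue measure *)

Section lebesgue_affine.
Local Open Scope ereal_scope.
Context (R : realType).
Local Notation mu := (@lebesgue_measure R).

Lemma measurable_affine (a b : R) :
  measurable_fun setT (fun x : R => (a * x + b)%R).
Proof. by apply: measurable_funD => //; exact: measurable_funM. Qed.

(** Uniqueness of Lebesgue measure: [a] times its image under the affine map has the right value on
    half-open intervals. *)
Lemma ge0_integral_affine (a b : R) (f : R -> \bar R) : (0 < a)%R ->
  measurable_fun setT f -> (forall x, 0 <= f x) ->
  \int[mu]_x f x = a%:E * \int[mu]_x f (a * x + b)%R.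
Proof.
move=> a0 mf f0.
have an0 : a != 0%R by rewrite gt_eqF.
pose h (x : R) : measurableTypeR R := (a * x + b)%R.
have mh : measurable_fun setT h by exact: measurable_affine.
pose k : {nonneg R} := NngNum (ltW a0).
pose nu : {measure set (measurableTypeR R) -> \bar R} :=
  mscale k (pushforward mu h).
have nuE A : measurable A -> mu A = nu mh A.
  move=> mA; apply: lebesgue_measure_unique => //= _ [[x y]] _ <-.
  rewrite /nu /mscale /= /pushforward.
  have -> : h @^-1` `]x, y]%classic = `]((x - b) / a)%R, ((y - b) / a)%R]%classic.
    apply/seteqP; split => z; rewrite /h /= !in_itv /= ltr_pdivrMr// ler_pdivlMr//;
    by rewrite ltrBlDr lerBrDr (mulrC z).
  rewrite !lebesgue_measure_itv /= !lte_fin ltr_pM2r ?invr_gt0// ltrD2r.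
  case: ifPn => _; last by rewrite mule0.
  by rewrite -!EFinD -EFinM; congr EFin; field.
rewrite (@eq_measure_integral _ _ _ _ (nu mh)); last by move=> A mA _; exact: nuE.
rewrite ge0_integral_mscale//= ge0_integral_pushforward//=.
Qed.

End lebesgue_affine.

(** * The one-dimensional normal law: densities, scaling, symmetry, rotation *)

Section normal.
Context (R : realType).
Local Notation mu := (@lebesgue_measure R).

Definition std_normal : probability (measurableTypeR R) R := @normal_prob R 0 1.

(** This is 1 / sqrt (2 pi), so [2 * gauss_cst R] is E|N|, the constant C of the overview. *)
Definition gauss_cst : R := normal_peak 1.

Lemma gauss_cst_gt0 : 0 < gauss_cst.
Proof. by rewrite normal_peak_gt0// oner_neq0. Qed.

Lemma normal_pdf_expR (m s x : R) : 0 < s ->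
  normal_pdf m s x = gauss_cst / s * expR (- ((x - m) / s) ^+ 2 / 2).
Proof.
move=> s0; rewrite normal_pdfE ?gt_eqF// /normal_fun; congr (_ * _).
  rewrite /gauss_cst /normal_peak expr1n mul1r -mulrnAr sqrtrM ?sqr_ge0//.
  by rewrite sqrtr_sqr gtr0_norm// invfM mulrC.
congr expR; rewrite -mulr_natr; field; rewrite ?gt_eqF//.
Qed.

Lemma std_pdf_expR (x : R) :
  normal_pdf 0 1 x = gauss_cst * expR (- x ^+ 2 / 2).
Proof. by rewrite normal_pdf_expR// !divr1 subr0. Qed.

Local Open Scope ereal_scope.

Lemma ge0_integral_normal_prob (m s : R) (f : R -> \bar R) :
  measurable_fun setT f -> (forall x, 0 <= f x) ->
  \int[normal_prob m s]_x f x = \int[mu]_x (f x * (normal_pdf m s x)%:E).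
Proof.
move=> mf f0; apply: ge0_integral_density => //.
- exact: measurable_normal_pdf.
- by move=> x; exact: normal_pdf_ge0.
Qed.

Lemma ge0_integral_normal_std (m s : R) (f : R -> \bar R) : (0 < s)%R ->
  measurable_fun setT f -> (forall x, 0 <= f x) ->
  \int[normal_prob m s]_x f x = \int[std_normal]_z f (s * z + m)%R.
Proof.
move=> s0 mf f0; rewrite ge0_integral_normal_prob//.
rewrite [RHS](@ge0_integral_normal_prob 0 1 (fun z => f (s * z + m)%R)); last 2 first.
- by apply: measurableT_comp => //; exact: measurable_affine.
- by [].
have mP : measurable_fun setT (fun x => f x * (normal_pdf m s x)%:E).
  apply: emeasurable_funM => //; apply/measurable_EFinP.
  exact: measurable_normal_pdf.
rewrite (@ge0_integral_affine _ s m)//; last first.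
  by move=> x; rewrite mule_ge0// lee_fin normal_pdf_ge0.
rewrite -ge0_integralZl//; last 3 first.
- by apply: (measurableT_comp mP); exact: measurable_affine.
- by move=> x _; rewrite mule_ge0// lee_fin normal_pdf_ge0.
- by rewrite lee_fin ltW.
apply: eq_integral => x _; rewrite muleCA -EFinM; congr (_ * _%:E).
rewrite !normal_pdf_expR// divr1 subr0 addrK.
have -> : (s * x / s)%R = x by field; rewrite gt_eqF.
by rewrite divr1; field; rewrite gt_eqF.
Qed.

Lemma ge0_integral_lebesgueN (f : R -> \bar R) :
  measurable_fun setT f -> (forall x, 0 <= f x) ->
  \int[mu]_x f (- x)%R = \int[mu]_x f x.
Proof.
move=> mf f0.
rewrite [RHS](@eq_measure_integral _ _ _ _ (pushforward mu (-%R : _ -> measurableTypeR R))); last first.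
  by move=> A mA _ /=; rewrite lebesgue_measureN.
by rewrite ge0_integral_pushforward.
Qed.

Lemma ge0_integral_stdN (f : R -> \bar R) :
  measurable_fun setT f -> (forall x, 0 <= f x) ->
  \int[std_normal]_z f (- z)%R = \int[std_normal]_z f z.
Proof.
move=> mf f0; rewrite [RHS](@ge0_integral_normal_prob 0 1 f)//.
rewrite [LHS](@ge0_integral_normal_prob 0 1 (fun z => f (- z)%R)); last 2 first.
- exact: measurableT_comp.
- by [].
transitivity (\int[mu]_x (f (- x)%R * (normal_pdf 0 1 (- x))%:E)).
  by apply: eq_integral => x _; rewrite !std_pdf_expR sqrrN.
apply: (@ge0_integral_lebesgueN (fun x => f x * (normal_pdf 0 1 x)%:E)).
- apply: emeasurable_funM => //; apply/measurable_EFinP.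
  exact: measurable_normal_pdf.
- by move=> x; rewrite mule_ge0// lee_fin normal_pdf_ge0.
Qed.

Lemma ge0_integral_std_scale (s : R) (f : R -> \bar R) :
  measurable_fun setT f -> (forall x, 0 <= f x) ->
  \int[std_normal]_z f (s * z)%R = \int[std_normal]_z f (`|s| * z)%R.
Proof.
move=> mf f0; have [s0|s0] := leP 0%R s; first by rewrite ger0_norm.
rewrite ltr0_norm// -ge0_integral_stdN//.
  by apply: eq_integral => x _; rewrite mulrN mulNr.
by apply: measurableT_comp => //; exact: measurable_funM.
Qed.

(** Two factorizations of the joint density of x and u = a x + b y for independent standard x and y:
    the law of x with that of u given x, and the law of u, of variance a^2 + b^2, with that of x
    given u. *)
Lemma normal_pdf_mul_rotate (a b x u : R) : (0 < b)%R ->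
  let r := Num.sqrt (a ^+ 2 + b ^+ 2) in
  (normal_pdf (a * x) b u * normal_pdf 0 1 x =
   normal_pdf 0 r u * normal_pdf (a * u / r ^+ 2) (b / r) x)%R.
Proof.
move=> b0 r.
have r20 : (0 < a ^+ 2 + b ^+ 2)%R.
  by rewrite ltr_wpDl ?sqr_ge0// exprn_gt0.
have r0 : (0 < r)%R by rewrite sqrtr_gt0.
have r2 : (r ^+ 2 = a ^+ 2 + b ^+ 2)%R by rewrite sqr_sqrtr// ltW.
have rn : r != 0%R by rewrite gt_eqF.
have bn : b != 0%R by rewrite gt_eqF.
have abn : (a ^+ 2 + b ^+ 2)%R != 0%R by rewrite gt_eqF.
rewrite !normal_pdf_expR ?divr_gt0// mulrACA [RHS]mulrACA -!expRD.
congr (_ * expR _)%R; first by field; rewrite rn bn.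
have -> : ((x - a * u / r ^+ 2) / (b / r) = (x - a * u / r ^+ 2) * r / b)%R.
  by field; rewrite rn bn.
have rV : ((u / r) ^+ 2 = u ^+ 2 / r ^+ 2)%R by rewrite expr_div_n.
rewrite !subr0 divr1 rV !expr_div_n exprMn r2.
by field; rewrite bn abn.
Qed.

Lemma measurable_normal_pdf2 (a b : R) : (0 < b)%R ->
  measurable_fun setT (fun z : R * R => normal_pdf (a * z.1) b z.2).
Proof.
move=> b0; under eq_fun do rewrite normal_pdf_expR//.
apply: measurable_funM => //; apply: measurableT_comp => //.
apply: measurable_funM => //; apply: measurableT_comp => //.
apply: measurable_funX => //; apply: measurable_funM => //.
by apply: measurable_funB => //; apply: measurable_funM.
Qed.

(** After the substitution u = a x + b y and Tonelli, [normal_pdf_mul_rotate] lets x be integrated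
    out against its conditional density given u, which has mass one. *)
Lemma ge0_integral_std_rotate (a b : R) (f : R -> \bar R) : (0 <= b)%R ->
  measurable_fun setT f -> (forall x, 0 <= f x) ->
  \int[std_normal]_x \int[std_normal]_y f (a * x + b * y)%R =
  \int[std_normal]_z f (Num.sqrt (a ^+ 2 + b ^+ 2) * z)%R.
Proof.
rewrite le_eqVlt => /predU1P[<-|b0] mf f0.
  (* For [b = 0] the law of u given x is degenerate and has no density; only the sign of [a] has to
     be absorbed, by symmetry. *)
  rewrite expr0n addr0 sqrtr_sqr -ge0_integral_std_scale//.
  apply: eq_integral => x _.
  under eq_integral do rewrite mul0r addr0.
  rewrite integral_cst// [X in _ * X](_ : _ = 1) ?mule1//.
  exact: (probability_setT std_normal).
set r := Num.sqrt _.
have r0 : (0 < r)%R by rewrite sqrtr_gt0 ltr_wpDl ?sqr_ge0// exprn_gt0.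
have mfs : measurable_fun setT (fun z : R * R => f z.2).
  by apply: measurableT_comp.
have mpdf1 : measurable_fun setT (fun z : R * R => (normal_pdf 0 1 z.1)%:E).
  apply/measurable_EFinP; apply: measurableT_comp => //.
  exact: measurable_normal_pdf.
have mpdf2 : measurable_fun setT (fun z : R * R => (normal_pdf (a * z.1) b z.2)%:E).
  by apply/measurable_EFinP; exact: measurable_normal_pdf2.
have mF : measurable_fun setT (fun z : R * R =>
    f z.2 * (normal_pdf (a * z.1) b z.2)%:E * (normal_pdf 0 1 z.1)%:E).
  by apply: emeasurable_funM => //; apply: emeasurable_funM.
transitivity (\int[std_normal]_x \int[normal_prob (a * x) b]_u f u).
  apply: eq_integral => x _; rewrite [RHS]ge0_integral_normal_std//.
  by under [RHS]eq_integral do rewrite addrC.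
have mI : measurable_fun setT (fun x : R =>
    \int[mu]_u (f u * (normal_pdf (a * x) b u)%:E)).
  apply: (@measurable_fun_fubini_tonelli_F _ _ _ _ _ mu
    (fun z : R * R => f z.2 * (normal_pdf (a * z.1) b z.2)%:E)).
    by apply: emeasurable_funM.
  by move=> x; rewrite mule_ge0// lee_fin normal_pdf_ge0.
under eq_integral do rewrite (@ge0_integral_normal_prob _ b f)//.
rewrite (@ge0_integral_normal_prob 0 1 (fun x =>
    \int[mu]_u (f u * (normal_pdf (a * x) b u)%:E)))//; last first.
  by move=> x; apply: integral_ge0 => u _; rewrite mule_ge0// lee_fin normal_pdf_ge0.
transitivity (\int[mu]_x \int[mu]_u
    (f u * (normal_pdf (a * x) b u)%:E * (normal_pdf 0 1 x)%:E)).
  apply: eq_integral => x _; rewrite ge0_integralZr//.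
  - apply: emeasurable_funM => //; apply/measurable_EFinP.
    exact: measurable_normal_pdf.
  - by move=> u _; rewrite mule_ge0// lee_fin normal_pdf_ge0.
  - by rewrite lee_fin normal_pdf_ge0.
rewrite (@fubini_tonelli _ _ _ _ _ mu mu (fun z : R * R =>
    f z.2 * (normal_pdf (a * z.1) b z.2)%:E * (normal_pdf 0 1 z.1)%:E))//; last first.
  by move=> x; rewrite !mule_ge0// lee_fin normal_pdf_ge0.
transitivity (\int[normal_prob 0 r]_u f u); last first.
  rewrite ge0_integral_normal_std//.
  by under eq_integral do rewrite addr0.
rewrite (@ge0_integral_normal_prob 0 r f)//; apply: eq_integral => u _ /=.
transitivity (\int[mu]_x (f u * (normal_pdf 0 r u)%:E *
    (normal_pdf (a * u / r ^+ 2) (b / r) x)%:E)).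
  apply: eq_integral => x _.
  by rewrite -!muleA -!EFinM normal_pdf_mul_rotate.
rewrite ge0_integralZl//.
- by rewrite integral_normal_pdf mule1.
- by apply/measurable_EFinP; exact: measurable_normal_pdf.
- by move=> x _; rewrite lee_fin normal_pdf_ge0.
- by rewrite mule_ge0// lee_fin normal_pdf_ge0.
Qed.

End normal.

(** * Stein's identity in dimension one *)

Section stein.
Context (R : realType).
Local Notation mu := (@lebesgue_measure R).

Lemma is_derive_gauss (x : R) :
  is_derive x 1 (fun z : R => expR (- z ^+ 2 / 2)) (- x * expR (- x ^+ 2 / 2)).
Proof.
have d1 : is_derive x 1 (fun z : R => - z ^+ 2 / 2) (- x).
  rewrite (_ : (fun z : R => - z ^+ 2 / 2) = (fun z => (- 2^-1) *: z ^+ 2)); last first.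
    by apply/funext => z; rewrite /GRing.scale /=; field.
  by apply: is_derive_eq; rewrite /GRing.scale /= ?mulr1; field.
have := @is_derive1_comp _ expR (fun z : R => - z ^+ 2 / 2) x _ _
  (is_derive_expR (- x ^+ 2 / 2)) d1.
by move=> h; apply: (is_derive_eq h); rewrite mulrC.
Qed.

Lemma continuous_gauss : continuous (fun z : R => expR (- z ^+ 2 / 2)).
Proof.
move=> x; apply: differentiable_continuous.
by apply/derivable1_diffP; have [] := is_derive_gauss x.
Qed.

Lemma cvgy_gauss : expR (- z ^+ 2 / 2) @[z --> +oo%R] --> (0 : R).
Proof.
under eq_fun do rewrite mulNr.
apply: (cvg_comp (fun z : R => z ^+ 2 / 2) (fun x => expR (- x))).
  by apply: gt0_cvgMly; [rewrite invr_gt0|exact: cvgr_expr2].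
exact: cvgr_expR.
Qed.

Lemma stein_half (f f' : R -> R) :
  (forall x : R, is_derive x 1 f (f' x)) -> continuous f' ->
  (forall x, `|f x| <= 1) -> (forall x, 0 <= f' x) ->
  (\int[mu]_(z in `[0%R, +oo[)
    (gauss_cst R * expR (- z ^+ 2 / 2) * (z - z * f z + f' z))%:E
   = (gauss_cst R * (1 - f 0))%:E)%E.
Proof.
move=> df cf' f1 f'0.
have cf : continuous f.
  move=> x; apply: differentiable_continuous.
  by apply/derivable1_diffP; have [] := df x.
(* Subtracting 1 from [f] adds the term z to the derivative. Since |f| <= 1, the integrand is then
   nonnegative on the half-line, as the fundamental theorem used here requires. *)
pose F z := gauss_cst R * (expR (- z ^+ 2 / 2) * (f z - 1)).
have dF (x : R) : is_derive x 1 F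
    (gauss_cst R * expR (- x ^+ 2 / 2) * (x - x * f x + f' x)).
  have dg := is_derive_gauss x; have dfx := df x.
  rewrite /F.
  rewrite (_ : (fun z => _) = (fun z : R => gauss_cst R *: (expR (- z ^+ 2 / 2) * (f z - 1)))); last by [].
  apply: is_derive_eq; rewrite /GRing.scale /=; ring.
rewrite (@ge0_continuous_FTC2y _ _ F 0 0).
- by rewrite -EFinB /F expr0n /= oppr0 mul0r expR0; congr EFin; ring.
- move=> x x0; rewrite mulr_ge0 ?mulr_ge0 ?expR_ge0 ?(ltW (gauss_cst_gt0 R))//.
  rewrite addr_ge0// subr_ge0 ler_piMr//.
  by have := f1 x; rewrite ler_norml => /andP[].
- apply: continuous_subspaceT => x.
  apply: cvgM.
    by apply: cvgM; [exact: cvg_cst|exact: continuous_gauss].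
  apply: cvgD; last exact: cf'.
  by apply: cvgB; [exact: cvg_id|apply: cvgM; [exact: cvg_id|exact: cf]].
- rewrite -[X in _ --> X](mulr0 (gauss_cst R)).
  apply: cvgM; first exact: cvg_cst.
  apply: (@squeeze_cvgr _ _ _ _ (fun z => - (2 * expR (- z ^+ 2 / 2)))
     (fun z => 2 * expR (- z ^+ 2 / 2))).
  + near=> z; rewrite -ler_norml normrM (ger0_norm (expR_ge0 _)) mulrC.
    rewrite ler_wpM2r ?expR_ge0//.
    by apply: (le_trans (ler_normB _ _)); rewrite normr1 lerD2r.
  + rewrite -oppr0 -[X in _ --> - X](mulr0 2).
    by apply: cvgN; apply: cvgM; [exact: cvg_cst|exact: cvgy_gauss].
  + rewrite -[X in _ --> X](mulr0 2).
    by apply: cvgM; [exact: cvg_cst|exact: cvgy_gauss].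
- by move=> x _; have [] := dF x.
- apply: cvg_at_right_filter; apply: differentiable_continuous.
  by apply/derivable1_diffP; have [] := dF 0.
- by move=> x _; rewrite derive1E; have [] := dF x.
Unshelve. all: by end_near. Qed.

Lemma ge0_integral_lebesgue_half (f : R -> \bar R) :
  measurable_fun setT f -> (forall x, 0 <= f x)%E ->
  (\int[mu]_x f x = \int[mu]_(x in `[0%R, +oo[) f x +
    \int[mu]_(x in `[0%R, +oo[) f (- x)%R)%E.
Proof.
move=> mf f0.
have -> : [set: R] = `[0, +oo[%classic `|` `]-oo, 0[%classic.
  by apply/seteqP; split => x //= _; rewrite !in_itv /= andbT; case: (leP 0 x); [left|right].
rewrite ge0_integral_setU//=; last 2 first.
- by apply: measurable_funTS.
- apply/disj_setPS => x [] /=; rewrite !in_itv /= andbT => a b.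
  by move: (le_lt_trans a b); rewrite ltxx.
congr (_ + _)%E; rewrite integral_itv_bndo_bndc; last exact: measurable_funTS.
rewrite [RHS]ge0_integration_by_substitution0//.
  by under [RHS]eq_integral do rewrite opprK.
exact: measurableT_comp.
Qed.

(** As the right-hand side is E|N|, this is the identity E f'(N) = E (N f(N)) with |z| added to keep
    the integrand nonnegative. The negative half-line is reflected, [f] turning into z -> - f (- z),
    and the two boundary values at 0 cancel. *)
Lemma stein_std_normal (f f' : R -> R) :
  (forall x : R, is_derive x 1 f (f' x)) -> continuous f' ->
  (forall x, `|f x| <= 1) -> (forall x, 0 <= f' x) ->
  (\int[std_normal R]_z (`|z| - z * f z + f' z)%:E = (2 * gauss_cst R)%:E)%E.
Proof.
move=> df cf' f1 f'0.
have cf : continuous f.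
  move=> x; apply: differentiable_continuous.
  by apply/derivable1_diffP; have [] := df x.
have mG : measurable_fun setT (fun z : R => (`|z| - z * f z + f' z)%:E).
  apply/measurable_EFinP; apply: measurable_funD; last exact: continuous_measurable_fun.
  apply: measurable_funB; first exact: normr_measurable.
  by apply: measurable_funM => //; exact: continuous_measurable_fun.
have G0 z : (0 <= (`|z| - z * f z + f' z)%:E)%E.
  rewrite lee_fin addr_ge0// subr_ge0 (le_trans (ler_norm _))// normrM.
  by rewrite ler_piMr.
rewrite (@ge0_integral_normal_prob _ 0 1 (fun z : R => (`|z| - z * f z + f' z)%:E))//.
rewrite ge0_integral_lebesgue_half//; last 2 first.
- apply: emeasurable_funM => //; apply/measurable_EFinP.
  exact: measurable_normal_pdf.
- by move=> x; rewrite mule_ge0// lee_fin normal_pdf_ge0.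
(* The constant is split into the values that [stein_half] gives for [f] and for its reflection. *)
have -> : 2 * gauss_cst R = gauss_cst R * (1 - f 0) +
    gauss_cst R * (1 - - f (- 0)) by rewrite oppr0; ring.
have df2 (x : R) : is_derive x 1 (fun z => - f (- z)) (f' (- x)).
  have dfx := df (- x).
  have := @is_derive1_comp _ f -%R x _ _ dfx (is_deriveN (is_derive_id x (1 : R))).
  by move=> /is_deriveN h; apply: (is_derive_eq h); rewrite mulrN1 opprK.
rewrite EFinD -(@stein_half f f')// -(@stein_half (fun z => - f (- z)) (fun z => f' (- z)))//.
- congr (_ + _)%E; apply: eq_integral => x /[!inE] /=; rewrite in_itv /= andbT => x0;
    rewrite -EFinM std_pdf_expR ?sqrrN ?normrN ger0_norm//; congr EFin; ring.
- move=> x; apply: continuous_comp; last exact: cf'.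
  exact: continuousN.
- by move=> x; rewrite normrN.
Qed.

Lemma integral_std_normal_norm :
  (\int[std_normal R]_z (`|z|)%:E = (2 * gauss_cst R)%:E)%E.
Proof.
rewrite -(@stein_std_normal (cst 0) (cst 0))//.
- by apply: eq_integral => z _; rewrite mulr0 subr0 addr0.
- by move=> x; exact: cvg_cst.
- by move=> x; rewrite normr0.
Qed.

End stein.

Section rvectors.
Context (R : realType) d (T : measurableType d) (p : nat).

Lemma measurable_inner (X Y : T -> 'rV[R]_p) :
  (forall i, measurable_fun setT (fun w => X w 0 i)) ->
  (forall i, measurable_fun setT (fun w => Y w 0 i)) ->
  measurable_fun setT (fun w => inner (X w) (Y w)).
Proof.
by move=> mX mY; apply: measurable_sum => i; apply: measurable_funM.
Qed.

Lemma measurable_norm2 (X : T -> 'rV[R]_p) :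
  (forall i, measurable_fun setT (fun w => X w 0 i)) ->
  measurable_fun setT (fun w => norm2 (X w)).
Proof.
move=> mX; have ms : measurable_fun setT (@Num.sqrt R).
  exact: continuous_measurable_fun (@sqrt_continuous R).
rewrite /norm2; apply: (measurableT_comp ms).
by apply: measurable_sum => i; exact: measurable_funX.
Qed.

End rvectors.

(** * The standard Gaussian vector *)

Section gaussian_tuple.
Context (R : realType).
Local Notation N := (std_normal R).

Definition tcons n (z : measurableTypeR R * n.-tuple R) : n.+1.-tuple R := [tuple of z.1 :: z.2].

Lemma measurable_tcons n : measurable_fun setT (@tcons n).
Proof. exact: measurable_cons. Qed.

HB.instance Definition _ n :=
  isMeasurableFun.Build _ _ _ _ (@tcons n) (measurable_tcons n).

(** The law is an iterated image of binary products, so that Tonelli in two variables peels off the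
    first coordinate, integrated either outermost or innermost. *)
Fixpoint gauss_tuple n : probability (n.-tuple R) R :=
  match n with
  | 0 => dirac [tuple]
  | m.+1 => distribution (N \x gauss_tuple m)%E (@tcons m)
  end.

Definition rowt n (v : n.-tuple R) : 'rV[R]_n := \row_i tnth v i.

Lemma measurable_rowt n i : measurable_fun setT (fun v : n.-tuple R => rowt n v 0 i).
Proof. by under eq_fun do rewrite mxE; exact: measurable_tnth. Qed.

Local Open Scope ereal_scope.

Section recursion.
Variables (n : nat) (f : n.+1.-tuple R -> \bar R).
Hypothesis mf : measurable_fun setT f.
Hypothesis f0 : forall v, 0 <= f v.

Let mf2 : measurable_fun setT (f \o @tcons n).
Proof. by apply: measurableT_comp => //; exact: measurable_tcons. Qed.

Lemma ge0_integral_gaussS :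
  \int[gauss_tuple n.+1]_v f v = \int[N]_x \int[gauss_tuple n]_v f (tcons n (x, v)).
Proof.
rewrite [LHS](@ge0_integral_distribution _ _ _ _ _ _ (@tcons n))//.
rewrite (@fubini_tonelli1 _ _ _ _ _ N (gauss_tuple n) (f \o @tcons n))//.
by move=> x; exact: f0.
Qed.

Lemma ge0_integral_gaussS_swap :
  \int[gauss_tuple n.+1]_v f v = \int[gauss_tuple n]_v \int[N]_x f (tcons n (x, v)).
Proof.
rewrite [LHS](@ge0_integral_distribution _ _ _ _ _ _ (@tcons n))//.
rewrite (@fubini_tonelli2 _ _ _ _ _ N (gauss_tuple n) (f \o @tcons n))//.
by move=> x; exact: f0.
Qed.

End recursion.

Lemma integral_gauss_cst n (c : \bar R) : \int[gauss_tuple n]_v c = c.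
Proof.
rewrite integral_cst// [X in _ * X](_ : _ = 1) ?mule1//.
exact: (probability_setT (gauss_tuple n)).
Qed.

Lemma integral_std_cst (c : \bar R) : \int[N]_v c = c.
Proof.
rewrite integral_cst// [X in _ * X](_ : _ = 1) ?mule1//.
exact: (probability_setT (std_normal R)).
Qed.

Definition tupd n (v : n.-tuple R) (i : 'I_n) (x : R) : n.-tuple R :=
  [tuple if j == i then x else tnth v j | j < n].

Lemma tcons_mkE n x (v : n.-tuple R) (g : 'I_n.+1 -> R) :
  g ord0 = x -> (forall j, g (lift ord0 j) = tnth v j) ->
  [tuple g j | j < n.+1] = tcons n (x, v).
Proof.
move=> g0 gS; apply: eq_from_tnth => j; rewrite tnth_mktuple /tcons /=.
by have [k ->|->] := unliftP ord0 j; rewrite ?gS ?tnthS// g0.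
Qed.

(** This is conditioning on all coordinates but one, in the only case needed: a constant conditional
    expectation. It lets Stein's identity be applied in a single coordinate with the others frozen.
    The induction peels the first coordinate until it reaches [i]. *)
Lemma ge0_integral_gauss_coord n (i : 'I_n) (f : n.-tuple R -> \bar R) (c : \bar R) :
  measurable_fun setT f -> (forall v, 0 <= f v) ->
  (forall v, \int[N]_x f (tupd n v i x) = c) -> \int[gauss_tuple n]_v f v = c.
Proof.
elim: n i f => [[]//|n IH] i f mf f0 fc.
have [j ij|i0] := unliftP ord0 i.
  rewrite ge0_integral_gaussS// -[RHS]integral_std_cst.
  apply: eq_integral => x _; apply: (IH j (fun v : n.-tuple R => f (tcons n (x, v)))) => //.
    apply: (measurableT_comp mf); apply: (@measurable_cons _ _ _ _ (fun=> x) n id) => //.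
  move=> v; rewrite -(fc (tcons n (x, v))); apply: eq_integral => y _; congr f.
  apply/esym/tcons_mkE => [|k].
    by rewrite ij (_ : _ == _ = false) ?/tcons//; apply/negbTE/eqP => /(congr1 val).
  rewrite ij tnth_mktuple (inj_eq (@lift_inj _ ord0)) /tcons /=.
  by case: ifP => // _; rewrite tnthS.
rewrite ge0_integral_gaussS_swap// -[RHS](integral_gauss_cst n).
(* The head 0 is a placeholder that [tupd] overwrites. *)
apply: eq_integral => v _; rewrite -(fc (tcons n (0%R, v : n.-tuple R))).
apply: eq_integral => x _; congr f.
apply/esym/tcons_mkE => [|k]; first by rewrite i0 eqxx.
rewrite i0 (_ : _ == _ = false) ?/tcons /= ?tnthS//.
Qed.

Definition rtail n (t : 'rV[R]_n.+1) : 'rV[R]_n := \row_i t 0%R (lift ord0 i).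

Lemma inner_tcons n (t : 'rV[R]_n.+1) x (v : n.-tuple R) :
  inner t (rowt n.+1 (tcons n (x, v))) =
  (t 0%R ord0 * x + inner (rtail n t) (rowt n v))%R.
Proof.
rewrite /inner big_ord_recl !mxE; congr (_ + _)%R.
by apply: eq_bigr => i _; rewrite !mxE tnthS.
Qed.

Lemma norm2_rtail n (t : 'rV[R]_n.+1) :
  norm2 t = Num.sqrt (t 0%R ord0 ^+ 2 + norm2 (rtail n t) ^+ 2)%R.
Proof.
rewrite {1}/norm2 big_ord_recl /= sqr_sqrtr ?sumr_ge0//; last first.
  by move=> i _; rewrite sqr_ge0.
by congr (Num.sqrt (_ + _)); apply: eq_bigr => i _; rewrite mxE.
Qed.

(** By induction the inner product of the tails is distributed as the norm of [rtail t] times N; one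
    planar rotation then merges it with the head. *)
Lemma ge0_integral_gauss_inner n (t : 'rV[R]_n) (f : R -> \bar R) :
  measurable_fun setT f -> (forall x, 0 <= f x) ->
  \int[gauss_tuple n]_v f (inner t (rowt n v)) = \int[N]_z f (norm2 t * z)%R.
Proof.
elim: n t f => [|n IH] t f mf f0.
  transitivity (f 0%R).
    rewrite -[RHS](integral_gauss_cst 0); apply: eq_integral => v _.
    by rewrite /inner big_ord0.
  rewrite -[LHS]integral_std_cst; apply: eq_integral => x _.
  by rewrite /norm2 big_ord0 sqrtr0 mul0r.
rewrite ge0_integral_gaussS//; last first.
  apply: measurableT_comp => //; apply: measurable_inner => // i.
  exact: measurable_rowt.
rewrite norm2_rtail -ge0_integral_std_rotate ?sqrtr_ge0//.
apply: eq_integral => x _.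
under eq_integral do rewrite inner_tcons.
apply: (IH _ (fun y => f (t 0%R ord0 * x + y)%R)) => //.
by apply: measurableT_comp => //; apply: measurable_funD.
Qed.

End gaussian_tuple.

(** * Absolute moments of one-dimensional Gaussian projections *)

Section gaussian_projections.
Context (R : realType).
Local Notation N := (std_normal R).
Local Open Scope ereal_scope.

Lemma normal_prob_scale (s : R) (B : set R) : (0 < s)%R -> measurable B ->
  normal_prob 0 s B = N ((fun z => s * z)%R @^-1` B).
Proof.
move=> s0 mB.
have mi : measurable_fun setT (EFin \o (\1_B : R -> R)).
  by apply/measurable_EFinP; exact: measurable_indic.
have := @ge0_integral_normal_std _ 0 s _ s0 mi.
rewrite integral_indic// setIT => -> //; last first.
  by move=> x; rewrite lee_fin.
under eq_integral do rewrite addr0.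
rewrite (_ : (fun z => _) = (fun z => (\1_((fun z => s * z)%R @^-1` B) z : R)%:E)).
  rewrite integral_indic// ?setIT//.
  rewrite -[X in measurable X]setTI.
  have mm : measurable_fun setT (fun z : R => s * z)%R by exact: measurable_funM.
  exact: mm.
by apply/funext => z; rewrite !indicE.
Qed.

Lemma measurable_abs_affine (m s : R) :
  measurable_fun setT (fun z : R => (`|m + s * z|%R)%:E).
Proof.
apply/measurable_EFinP; apply: measurableT_comp => //.
by apply: measurable_funD => //; exact: measurable_funM.
Qed.

Lemma integral_gauss_abs_inner p (y : 'rV[R]_p) :
  \int[gauss_tuple R p]_t (`|inner y (rowt R p t)|%R)%:E =
  (2 * gauss_cst R * norm2 y)%:E.
Proof.
rewrite (@ge0_integral_gauss_inner _ _ y (fun x => (`|x|%R)%:E))//; last first.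
  by apply/measurable_EFinP.
under eq_integral do rewrite normrM ger0_norm ?sqrtr_ge0// EFinM.
rewrite ge0_integralZl// ?lee_fin ?sqrtr_ge0//; last first.
  by apply/measurable_EFinP.
by rewrite integral_std_normal_norm -EFinM mulrC.
Qed.

(** By symmetry z may be averaged with -z, and (|m + x| + |m - x|) / 2 = max (|m|, |x|). *)
Lemma integral_std_abs_max (m s : R) :
  \int[N]_z (`|m + s * z|%R)%:E = \int[N]_z (Order.max `|m| `|s * z|)%:E.
Proof.
have E : \int[N]_z (`|m + s * z|%R)%:E = \int[N]_z (`|m - s * z|%R)%:E.
  rewrite -(@ge0_integral_stdN _ (fun z => (`|m + s * z|%R)%:E))//.
    by under eq_integral do rewrite mulrN.
  exact: measurable_abs_affine.
have mm : measurable_fun setT (fun z : R => (`|m - s * z|%R)%:E).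
  by under eq_fun do rewrite -mulNr; exact: measurable_abs_affine.
(* Valid for infinite [x] as well, so the averaging needs no finiteness. *)
have two (x : \bar R) : x = 2^-1%:E * (x + x).
  case: x => [r| |]; rewrite ?gt0_mulye ?gt0_muleNy ?gt0_muley ?lte_fin ?invr_gt0//.
  by rewrite -EFinD -EFinM; congr EFin; lra.
rewrite [LHS]two {2}E -ge0_integralD//; last exact: measurable_abs_affine.
rewrite -ge0_integralZl//; last 2 first.
- by apply: emeasurable_funD => //; exact: measurable_abs_affine.
- by move=> z _; rewrite adde_ge0.
apply: eq_integral => z _; rewrite -EFinD -EFinM; congr EFin.
move: (s * z)%R => x; rewrite /Order.max.
by case: ltP; case: (ler0P m); case: (ler0P x); case: (ler0P (m + x)%R);
  case: (ler0P (m - x)%R) => *; lra.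
Qed.

(** Shrinking the deviation by the factor [k] costs more for [sg] than for the smaller [s]. With
    sums on both sides this needs no subtraction of integrals, and after [integral_std_abs_max] it
    holds pointwise in z. *)
Lemma std_abs_supermodular (m s sg k : R) :
  (0 <= s <= sg)%R -> (0 <= k <= 1)%R ->
  \int[N]_z (`|m + k * sg * z|%R)%:E + \int[N]_z (`|m + s * z|%R)%:E <=
  \int[N]_z (`|m + sg * z|%R)%:E + \int[N]_z (`|m + k * s * z|%R)%:E.
Proof.
move=> /andP[s0 ssg] /andP[k0 k1]; rewrite !integral_std_abs_max.
have mM c : measurable_fun setT (fun z : R => (Order.max `|m| `|c * z|)%:E).
  apply/measurable_EFinP; apply: measurable_maxr => //.
  by apply: measurableT_comp => //; exact: measurable_funM.
have M0 c z : 0 <= (Order.max `|m| `|c * z|)%:E by rewrite lee_fin le_max normr_ge0.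
rewrite -ge0_integralD; [|by []|by move=> z _; exact: M0|exact: mM|by move=> z _; exact: M0|exact: mM].
rewrite -[leRHS]ge0_integralD; [|by []|by move=> z _; exact: M0|exact: mM|by move=> z _; exact: M0|exact: mM].
apply: ge0_le_integral => //.
- by move=> z _; rewrite adde_ge0// M0.
- by apply: emeasurable_funD; exact: mM.
- by apply: emeasurable_funD; exact: mM.
move=> z _; rewrite -!EFinD lee_fin !normrM.
have sg0 := le_trans s0 ssg.
rewrite (ger0_norm k0) (ger0_norm s0) (ger0_norm sg0) -!mulrA.
have : (s * `|z| <= sg * `|z|)%R by rewrite ler_wpM2r.
have : (0 <= s * `|z|)%R by rewrite mulr_ge0.
move: (s * `|z|)%R (sg * `|z|)%R `|m|%R => x y a x0 xy.
have h1 : (k * x <= x)%R by rewrite ler_piMl.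
have h2 : (k * y <= y)%R by rewrite ler_piMl// (le_trans x0).
have h3 : (k * x <= k * y)%R by rewrite ler_wpM2l.
(* This is the case where every maximum is reached by its second argument; the other cases follow
   from [h1], [h2], [h3] and [xy]. *)
have h4 : (x - k * x <= y - k * y)%R.
  by rewrite -subr_ge0 (_ : _ - _ = (1 - k) * (y - x))%R ?mulr_ge0 ?subr_ge0//; ring.
by rewrite /Order.max; do 4 (case: ltP => ?); lra.
Qed.

End gaussian_projections.

(** * Gaussian variance mixtures and projections of random vectors *)

Section gaussian_mixture.
Local Open Scope ereal_scope.
Context d (T : measurableType d) (R : realType) (P : probability T R).
Local Notation N := (std_normal R).

(** The hypothesis on sets says that [X] under [P] has the law of [sg w * z] under the product of
    [P] and the standard normal law; equal laws give equal integrals. *)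
Lemma ge0_integral_normal_mixture (X sg : T -> R) (h : R -> \bar R) :
  measurable_fun setT X -> measurable_fun setT sg -> (forall w, 0 < sg w)%R ->
  (forall B, measurable B ->
    P (X @^-1` B) = \int[P]_w normal_prob 0 (sg w) B) ->
  measurable_fun setT h -> (forall x, 0 <= h x) ->
  \int[P]_w h (X w) = \int[P]_w \int[N]_z h (sg w * z)%R.
Proof.
move=> mX msg sg0 law mh h0.
pose Z (u : T * measurableTypeR R) : measurableTypeR R := (sg u.1 * u.2)%R.
have mZ : measurable_fun setT Z.
  by apply: measurable_funM => //; exact: measurableT_comp.
pose X' : T -> measurableTypeR R := X.
have mX' : measurable_fun setT X' by [].
transitivity (\int[pushforward P X']_x h x).
  by rewrite ge0_integral_pushforward.
transitivity (\int[pushforward (P \x N) Z]_x h x); last first.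
  rewrite ge0_integral_pushforward//=.
  rewrite (@fubini_tonelli1 _ _ _ _ _ P N (h \o Z))//.
    exact: measurableT_comp.
  by move=> x; exact: h0.
apply: eq_measure_integral => B mB _; etransitivity; first exact: (law B mB).
rewrite /= /pushforward.
rewrite /product_measure1; apply: eq_integral => w _ /=.
etransitivity; first exact: (normal_prob_scale _ (sg w) B (sg0 w) mB).
by congr (std_normal R _); apply/seteqP; split => z /=; rewrite /xsection /= inE.
Qed.

Lemma integral_norm2_projections p (X : T -> 'rV[R]_p) :
  (forall i, measurable_fun setT (fun w => X w 0%R i)) ->
  (2 * gauss_cst R)%:E * \int[P]_w (norm2 (X w))%:E =
  \int[gauss_tuple R p]_t \int[P]_w (`|inner (X w) (rowt R p t)|%R)%:E.
Proof.
move=> mX.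
rewrite -ge0_integralZl//; last 3 first.
- by apply/measurable_EFinP; exact: measurable_norm2.
- by move=> w _; rewrite lee_fin sqrtr_ge0.
- by rewrite lee_fin mulr_ge0// ltW// gauss_cst_gt0.
under eq_integral do rewrite -EFinM -integral_gauss_abs_inner.
rewrite (@fubini_tonelli _ _ _ _ _ P (gauss_tuple R p)
  (fun u => (`|inner (X u.1) (rowt R p u.2)|%R)%:E))//.
apply/measurable_EFinP; apply: measurableT_comp => //.
apply: measurable_inner => i.
  exact: (measurableT_comp (mX i)).
exact: (measurableT_comp (measurable_rowt R p i)).
Qed.

Lemma measurable_projections p (X : T -> 'rV[R]_p) :
  (forall i, measurable_fun setT (fun w => X w 0%R i)) ->
  measurable_fun setT (fun t : p.-tuple R =>
    \int[P]_w (`|inner (X w) (rowt R p t)|%R)%:E).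
Proof.
move=> mX; apply: (@measurable_fun_fubini_tonelli_G _ _ _ _ _ P
  (fun u => (`|inner (X u.1) (rowt R p u.2)|%R)%:E))=> //.
apply/measurable_EFinP; apply: measurableT_comp => //.
apply: measurable_inner => i.
  exact: (measurableT_comp (mX i)).
exact: (measurableT_comp (measurable_rowt R p i)).
Qed.

End gaussian_mixture.

Section inner_lemmas.
Context (R : realType) (p : nat).
Implicit Types u v w : 'rV[R]_p.

Lemma innerC u v : inner u v = inner v u.
Proof. by apply: eq_bigr => i _; rewrite mulrC. Qed.

Lemma innerDl u v w : inner (u + v) w = inner u w + inner v w.
Proof. by rewrite -big_split; apply: eq_bigr => i _; rewrite mxE mulrDl. Qed.

Lemma innerZl (k : R) u v : inner (k *: u) v = k * inner u v.
Proof. by rewrite mulr_sumr; apply: eq_bigr => i _; rewrite mxE mulrA. Qed.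

Lemma inner0r u : inner u 0 = 0.
Proof. by apply: big1 => i _; rewrite mxE mulr0. Qed.

Lemma norm2_ge0 u : 0 <= norm2 u.
Proof. exact: sqrtr_ge0. Qed.

Lemma sqr_norm2 u : norm2 u ^+ 2 = inner u u.
Proof.
rewrite sqr_sqrtr; last by apply: sumr_ge0 => i _; rewrite sqr_ge0.
by apply: eq_bigr => i _; rewrite expr2.
Qed.

End inner_lemmas.

Lemma ae_ge0_le_integral2 d (T : measurableType d) (R : realType)
    (mu : {measure set T -> \bar R}) (f1 f2 g1 g2 : T -> \bar R) :
  measurable_fun setT f1 -> measurable_fun setT f2 ->
  measurable_fun setT g1 -> measurable_fun setT g2 ->
  (forall x, 0 <= f1 x)%E -> (forall x, 0 <= f2 x)%E ->
  (forall x, 0 <= g1 x)%E -> (forall x, 0 <= g2 x)%E ->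
  {ae mu, forall x, (f1 x + f2 x <= g1 x + g2 x)%E} ->
  (\int[mu]_x f1 x + \int[mu]_x f2 x <= \int[mu]_x g1 x + \int[mu]_x g2 x)%E.
Proof.
move=> mf1 mf2 mg1 mg2 f10 f20 g10 g20 fg.
rewrite -[leLHS]ge0_integralD// -[leRHS]ge0_integralD//.
apply: ae_ge0_le_integral => //.
- by move=> x _; rewrite adde_ge0.
- exact: emeasurable_funD.
- by move=> x _; rewrite adde_ge0.
- exact: emeasurable_funD.
by apply: filterS fg => x + _.
Qed.

(** * Comparison of the random covariance with a multiple of the identity *)

Section covariance_comparison.
Local Open Scope ereal_scope.
Context d (T : measurableType d) (R : realType) (P : probability T R) (p : nat).
Variables (theta : 'rV[R]_p) (xi : T -> 'rV[R]_p) (sg : 'rV[R]_p -> T -> R) (s k : R).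
Local Notation N := (std_normal R).
Local Notation G := (gauss_tuple R p).
Hypothesis mxi : forall i, measurable_fun setT (fun w => xi w 0%R i).
Hypothesis msg : forall t, measurable_fun setT (sg t).
Hypothesis sg0 : forall t, t != 0%R -> forall w, (0 < sg t w)%R.
Hypothesis law : forall t, t != 0%R -> forall B, measurable B ->
  P ((fun w => inner t (xi w)) @^-1` B) = \int[P]_w normal_prob 0 (sg t w) B.
Hypothesis sg_ge : forall t, t != 0%R -> {ae P, forall w, (s * norm2 t <= sg t w)%R}.
Hypothesis s0 : (0 <= s)%R.
Hypothesis k01 : (0 <= k <= 1)%R.

Let mint (m c : R) t :
  measurable_fun setT (fun w => \int[N]_z (`|m + c * sg t w * z|%R)%:E).
Proof.
apply: (@measurable_fun_fubini_tonelli_F _ _ _ _ _ N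
  (fun u => (`|m + c * sg t u.1 * u.2|%R)%:E)) => //.
apply/measurable_EFinP; apply: measurableT_comp => //.
apply: measurable_funD => //; apply: measurable_funM => //.
by apply: measurable_funM => //; exact: measurableT_comp.
Qed.

Let int0 (m c : R) : 0 <= \int[N]_z (`|m + c * z|%R)%:E.
Proof. exact: integral_ge0. Qed.

Let projP (c : R) t : t != 0%R ->
  \int[P]_w (`|inner (theta + c *: xi w) t|%R)%:E =
  \int[P]_w \int[N]_z (`|inner theta t + c * sg t w * z|%R)%:E.
Proof.
move=> t0.
have mh : measurable_fun setT (fun x : R => (`|inner theta t + c * x|%R)%:E).
  exact: measurable_abs_affine.
have mX : measurable_fun setT (fun w => inner t (xi w)).
  by apply: measurable_inner => // i; exact: measurable_cst.
have := @ge0_integral_normal_mixture _ _ _ P _ _ _ mX (msg t) (sg0 _ t0)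
  (law _ t0) mh (fun x => normr_ge0 _).
under [X in X = _ -> _]eq_integral do rewrite (innerC _ _ t) -innerZl -innerDl.
move=> ->; apply: eq_integral => w _; apply: eq_integral => z _.
by rewrite mulrA.
Qed.

Let projG (c : R) t :
  \int[G]_v (`|inner (theta + c *: rowt R p v) t|%R)%:E =
  \int[N]_z (`|inner theta t + c * norm2 t * z|%R)%:E.
Proof.
have mh : measurable_fun setT (fun x : R => (`|inner theta t + c * x|%R)%:E).
  exact: measurable_abs_affine.
transitivity (\int[N]_z (`|inner theta t + c * (norm2 t * z)|%R)%:E); last first.
  by apply: eq_integral => z _; rewrite mulrA.
rewrite -(@ge0_integral_gauss_inner _ _ t _ mh)//.
by apply: eq_integral => v _; rewrite innerDl innerZl (innerC _ _ (rowt R p v)).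
Qed.

Let measurable_shift dS (Q : measurableType dS) (X : Q -> 'rV[R]_p) (c : R) :
  (forall i, measurable_fun setT (fun w => X w 0%R i)) ->
  forall i, measurable_fun setT (fun w => (theta + c *: X w)%R 0%R i).
Proof.
move=> mX i; under eq_fun do rewrite !mxE.
by apply: measurable_funD => //; exact: measurable_funM.
Qed.

(** Multiplied by E|N|, each term becomes an average over Gaussian directions t of absolute
    projections. For fixed t and w, the inequality is [std_abs_supermodular] with deviations
    [s * norm2 t] and [sg t w]. *)
Lemma norm2_mixture_comparison :
  \int[P]_w (norm2 (theta + k *: xi w))%:E +
  \int[G]_v (norm2 (theta + s *: rowt R p v))%:E <=
  \int[P]_w (norm2 (theta + xi w))%:E +
  \int[G]_v (norm2 (theta + (k * s) *: rowt R p v))%:E.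
Proof.
have C0 : (0 < 2 * gauss_cst R)%R by rewrite mulr_gt0// gauss_cst_gt0.
have mP c := measurable_shift _ T xi c mxi.
have mG c := measurable_shift _ _ (rowt R p) c (measurable_rowt R p).
rewrite (_ : (fun w => (norm2 (theta + xi w))%:E) =
             (fun w => (norm2 (theta + 1%R *: xi w))%:E)); last first.
  by apply/funext => w; rewrite scale1r.
rewrite -(@lee_pmul2l _ (2 * gauss_cst R)%:E)//.
have i0 dQ (Q : measurableType dQ) (M : {measure set Q -> \bar R}) (f : Q -> 'rV[R]_p) :
    0 <= \int[M]_w (norm2 (f w))%:E.
  by apply: integral_ge0 => w _; rewrite lee_fin norm2_ge0.
rewrite [leLHS]ge0_muleDr; [|exact: i0|exact: i0].
rewrite [leRHS]ge0_muleDr; [|exact: i0|exact: i0].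
rewrite (integral_norm2_projections _ T R P p _ (mP k)).
rewrite (integral_norm2_projections _ T R P p _ (mP 1%R)).
rewrite (integral_norm2_projections _ _ R G p _ (mG s)).
rewrite (integral_norm2_projections _ _ R G p _ (mG (k * s)%R)).
have mpP c := measurable_projections _ _ _ P _ _ (mP c).
have mpG c := measurable_projections _ _ _ G _ _ (mG c).
apply: ae_ge0_le_integral2 => //; try by move=> t; exact: integral_ge0.
apply: aeW => /= t; move: (rowt R p t) => {}t.
(* The law of the projections is given only for nonzero t; for t = 0 all four terms vanish. *)
have [->|t0] := eqVneq t 0%R.
  have Z dQ (Q : measurableType dQ) (M : {measure set Q -> \bar R}) (f : Q -> 'rV[R]_p) :
      \int[M]_w (`|inner (f w) 0%R|%R)%:E = 0.
    by apply: integral0_eq => w _; rewrite inner0r normr0.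
  by rewrite !Z.
rewrite !projP// !projG.
(* The Gaussian terms do not depend on w; rewriting them as integrals over [P] puts both sides under
   one integral. *)
have cstP (x : \bar R) : x = \int[P]_w x.
  rewrite integral_cst// [X in _ = _ * X](_ : _ = 1) ?mule1//.
  exact: (probability_setT P).
rewrite [X in _ + X <= _]cstP [X in _ <= _ + X]cstP.
apply: ae_ge0_le_integral2 => //; try by move=> w; exact: integral_ge0.
apply: filterS (sg_ge t t0) => w hw.
rewrite mul1r -mulrA; apply: std_abs_supermodular => //.
by rewrite hw mulr_ge0 ?norm2_ge0.
Qed.

End covariance_comparison.

(** * The Euclidean norm and its smooth approximation *)

Section euclidean_norm.
Context (R : realType) (p : nat).
Implicit Types u v w : 'rV[R]_p.

Lemma innerDr u v w : inner u (v + w) = inner u v + inner u w.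
Proof. by rewrite innerC innerDl !(innerC _ _ u). Qed.

Lemma innerZr (k : R) u v : inner u (k *: v) = k * inner u v.
Proof. by rewrite innerC innerZl innerC. Qed.

Lemma inner_ge0 u : 0 <= inner u u.
Proof. by rewrite -sqr_norm2 sqr_ge0. Qed.

Lemma inner_eq0 u : inner u u = 0 -> u = 0.
Proof.
move=> u0; apply/rowP => i; rewrite mxE.
have F j : true -> 0 <= u 0 j * u 0 j by rewrite -expr2 sqr_ge0.
have := @psumr_eq0P _ _ _ _ F u0 i isT.
by move/eqP; rewrite mulf_eq0 orbb => /eqP.
Qed.

Lemma sqr_inner_le u v : inner u v ^+ 2 <= inner u u * inner v v.
Proof.
have [v0|vn0] := eqVneq (inner v v) 0.
  by rewrite (inner_eq0 v v0) !inner0r expr0n mulr0.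
have vp : 0 < inner v v by rewrite lt_def vn0 inner_ge0.
have := inner_ge0 (u + (- (inner u v / inner v v)) *: v).
rewrite innerDl !innerDr !innerZl !innerZr (innerC _ _ v u).
move: (inner u v) (inner u u) (inner v v) vn0 vp => b a c cn0 c0 h.
rewrite -subr_ge0 (_ : _ - _ = c * (a + - (b / c) * b +
  (- (b / c) * b + - (b / c) * (- (b / c) * c)))).
  by rewrite mulr_ge0// ltW.
by field.
Qed.

Lemma inner_le_norm2 u v : inner u v <= norm2 u * norm2 v.
Proof.
rewrite (le_trans (ler_norm _))// -ler_sqr ?nnegrE ?mulr_ge0 ?norm2_ge0//.
by rewrite (real_normK (num_real _)) exprMn !sqr_norm2 sqr_inner_le.
Qed.

Lemma ler_norm2D u v : norm2 (u + v) <= norm2 u + norm2 v.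
Proof.
rewrite -ler_sqr ?nnegrE ?addr_ge0 ?norm2_ge0// sqrrD !sqr_norm2.
rewrite innerDl !innerDr (innerC _ _ v u).
by have := inner_le_norm2 u v; lra.
Qed.

Lemma norm2Z (k : R) u : norm2 (k *: u) = `|k| * norm2 u.
Proof.
apply/eqP; rewrite -(@eqrXn2 _ 2)// ?mulr_ge0 ?norm2_ge0//.
by rewrite exprMn !sqr_norm2 innerZl innerZr mulrA -expr2 real_normK// num_real.
Qed.

Lemma norm2_le_sum u : norm2 u <= \sum_i `|u 0 i|.
Proof.
rewrite -ler_sqr ?nnegrE ?norm2_ge0 ?sumr_ge0// sqr_norm2 /inner.
(* Nonnegativity of the partial sums travels with the induction because it signs the cross term of
   the square. *)
suff [_ //] : 0 <= \sum_i `|u 0 i| /\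
  \sum_i u 0 i * u 0 i <= (\sum_i `|u 0 i|) ^+ 2.
elim/big_rec2: _ => [|i x y _ [y0 xy]]; first by rewrite expr0n.
split; first by rewrite addr_ge0.
rewrite sqrrD (real_normK (num_real _)) -expr2 lerD// lerDl.
by rewrite mulrn_wge0// mulr_ge0.
Qed.

(** For positive [eps] this is the norm of (u, sqrt eps) in one more dimension: it is smooth, never
    zero, and inherits convexity. *)
Definition snorm (eps : R) u : R := Num.sqrt (inner u u + eps).

Lemma snorm_gt0 eps u : 0 < eps -> 0 < snorm eps u.
Proof. by move=> e0; rewrite sqrtr_gt0 ltr_wpDl ?inner_ge0. Qed.

Lemma sqr_snorm eps u : 0 < eps -> snorm eps u ^+ 2 = inner u u + eps.
Proof. by move=> e0; rewrite sqr_sqrtr// addr_ge0 ?inner_ge0// ltW. Qed.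

Lemma norm2_le_snorm eps u : 0 < eps -> norm2 u <= snorm eps u.
Proof.
move=> e0; rewrite -ler_sqr ?nnegrE ?norm2_ge0 ?(ltW (snorm_gt0 _ _ _))//.
by rewrite sqr_snorm// sqr_norm2 lerDl ltW.
Qed.

Lemma snorm_le_norm2 e u : 0 < e -> snorm (e ^+ 2) u <= norm2 u + e.
Proof.
move=> e0; have e20 : 0 < e ^+ 2 by rewrite exprn_gt0.
rewrite -ler_sqr ?nnegrE ?(ltW (snorm_gt0 _ _ _))//; last first.
  by rewrite addr_ge0 ?norm2_ge0// ltW.
rewrite sqr_snorm// sqrrD sqr_norm2 lerD2r lerDl mulrn_wge0//.
by rewrite mulr_ge0 ?norm2_ge0// ltW.
Qed.

(** The tangent inequality at [u] is Cauchy-Schwarz for (u, sqrt eps) and (u + h, sqrt eps). After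
    squaring, with a = <u, u>, b = <u, h>, c = <h, h>, the two sides differ by (a c - b^2) + eps
    c. *)
Lemma snorm_convex eps u h : 0 < eps ->
  snorm eps u + inner h u / snorm eps u <= snorm eps (u + h).
Proof.
move=> e0; have n0 := snorm_gt0 _ u e0; have m0 := snorm_gt0 _ (u + h) e0.
rewrite -(ler_pM2r n0) mulrDl divfK ?gt_eqF// -expr2 sqr_snorm//.
rewrite (le_trans (ler_norm _))// -ler_sqr ?nnegrE ?mulr_ge0 ?(ltW n0) ?(ltW m0)//.
rewrite (real_normK (num_real _)) exprMn !sqr_snorm//.
have := sqr_inner_le (u + h) u; have := inner_ge0 (u + h - u).
rewrite !(innerDl, innerDr) -scaleN1r !(innerZl, innerZr) !(innerC _ _ h u).
have := inner_ge0 h; have := inner_ge0 u.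
move: (inner u u) (inner u h) (inner h h) => a b c a0 c0 _ h1.
have : 0 <= eps * c by rewrite mulr_ge0// ltW.
by move: h1; rewrite !expr2; nra.
Qed.

End euclidean_norm.

(** * Stein's identity for the smoothed direction, coordinate by coordinate *)

Section gaussian_stein.
Context (R : realType).
Local Notation N := (std_normal R).

Lemma measurable_invr : measurable_fun setT (fun x : R => x^-1).
Proof.
have -> : [set: R] = [set x | x != 0] `|` [set 0].
  by apply/seteqP; split => x //= _; have [->|] := eqVneq x 0; [right|left].
have oD : open [set x : R | x != 0].
  have -> : [set x : R | x != 0] = ~` [set 0].
    by apply/seteqP; split => x /= /eqP.
  exact/closed_openC/closed_eq.
apply/measurable_funU => //; first exact: open_measurable.
split; last exact: measurable_fun_set1.
apply: open_continuous_measurable_fun => // x; rewrite inE /= => x0.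
exact: inv_continuous.
Qed.

Lemma measurable_funV d (T : measurableType d) (f : T -> R) :
  measurable_fun setT f -> measurable_fun setT (fun x => (f x)^-1).
Proof. exact: measurableT_comp measurable_invr. Qed.

Lemma measurable_snorm d (T : measurableType d) p (eps : R) (X : T -> 'rV[R]_p) :
  (forall i, measurable_fun setT (fun w => X w 0 i)) ->
  measurable_fun setT (fun w => snorm R p eps (X w)).
Proof.
move=> mX; have ms : measurable_fun setT (@Num.sqrt R).
  exact: continuous_measurable_fun (@sqrt_continuous R).
rewrite /snorm; apply: (measurableT_comp ms).
by apply: measurable_funD => //; exact: measurable_inner.
Qed.

Lemma measurable_translate d (T : measurableType d) p (u : 'rV[R]_p) (c : R)
    (X : T -> 'rV[R]_p) :
  (forall i, measurable_fun setT (fun w => X w 0 i)) ->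
  forall i, measurable_fun setT (fun w => (u + c *: X w) 0 i).
Proof.
move=> mX i; under eq_fun do rewrite !mxE.
by apply: measurable_funD => //; exact: measurable_funM.
Qed.

Section one_dim.
Variables (a s q : R).
Hypothesis q0 : 0 < q.
Hypothesis s0 : 0 <= s.
Let r x := Num.sqrt ((a + s * x) ^+ 2 + q).

Let r20 x : 0 < (a + s * x) ^+ 2 + q.
Proof. by rewrite ltr_wpDl ?sqr_ge0. Qed.

Let r0 x : 0 < r x.
Proof. by rewrite sqrtr_gt0. Qed.

Let r2 x : r x ^+ 2 = (a + s * x) ^+ 2 + q.
Proof. by rewrite sqr_sqrtr// ltW. Qed.

Let is_derive_r (x : R) : is_derive x 1 r (s * (a + s * x) / r x).
Proof.
have d1 : is_derive x 1 (fun x : R => (a + s * x) ^+ 2 + q) (2 * s * (a + s * x)).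
  rewrite (_ : (fun x : R => _) = (fun x : R => (a + s *: x) ^+ 2 + q))//.
  by apply: is_derive_eq; rewrite /GRing.scale /=; ring.
have := @is_derive1_comp _ Num.sqrt _ x _ _ (is_derive1_sqrt (r20 x)) d1.
move=> h; apply: (is_derive_eq h); rewrite -/(r x).
by have := r0 x; move: (r x) => t t0; field; rewrite gt_eqF.
Qed.

Let is_derive_g (x : R) :
  is_derive x 1 (fun x => (a + s * x) / r x) (s * q / r x ^+ 3).
Proof.
have dr := is_derive_r x.
have rn : r x != 0 by rewrite gt_eqF.
have dV := @is_deriveV _ r x _ 1 rn dr.
have dl : is_derive x 1 (fun x : R => a + s * x) s.
  rewrite (_ : (fun x : R => _) = (fun x : R => a + s *: x))//.
  by apply: is_derive_eq; rewrite /GRing.scale /=; ring.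
have := is_deriveM dl dV.
move=> h; apply: (is_derive_eq h); rewrite /GRing.scale /=.
have -> : q = r x ^+ 2 - (a + s * x) ^+ 2 by rewrite r2; ring.
by move: rn; move: (r x) => t t0; field.
Qed.

(** The ratio (a + s x) / r is bounded by 1, and its derivative s (r^2 - (a + s x)^2) / r^3 = s q /
    r^3 is nonnegative, as [stein_std_normal] requires. *)
Lemma stein_smooth_ratio :
  (\int[N]_x (`|x| - x * ((a + s * x) / r x) + s * q / r x ^+ 3)%:E =
   (2 * gauss_cst R)%:E)%E.
Proof.
apply: (stein_std_normal _ (fun x => (a + s * x) / r x) (fun x => s * q / r x ^+ 3)).
- exact: is_derive_g.
- move=> x; apply: cvgM; first exact: cvg_cst.
  apply: cvgV; first by rewrite expf_neq0// gt_eqF.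
  apply: (@continuous_comp _ _ _ r (fun x => x ^+ 3)).
    apply: differentiable_continuous; apply/derivable1_diffP.
    by have [] := is_derive_r x.
  exact: exprn_continuous.
- move=> x; rewrite normrM normfV (gtr0_norm (r0 x)) ler_pdivrMr// mul1r.
  rewrite -ler_sqr ?nnegrE ?(ltW (r0 x))// r2 real_normK ?num_real//.
  by rewrite lerDl ltW.
- by move=> x; rewrite divr_ge0 ?mulr_ge0 ?exprn_ge0 ?(ltW (r0 x))// ltW.
Qed.

End one_dim.

Section coordinates.
Variables (p : nat) (theta : 'rV[R]_p) (s eps : R).
Hypothesis eps0 : 0 < eps.
Hypothesis s0 : 0 <= s.
Local Notation G := (gauss_tuple R p).
Let y (v : p.-tuple R) := theta + s *: rowt R p v.
Let n v := snorm R p eps (y v).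

(** The Stein integrand in coordinate i for the field y / n. The difference n^2 - y_i^2 is the [q]
    of the one-dimensional identity, expressed through the whole vector so that the sum over i can
    be computed. *)
Definition stein_term (i : 'I_p) (v : p.-tuple R) : R :=
  `|tnth v i| - tnth v i * (y v 0 i / n v) +
  s * (n v ^+ 2 - y v 0 i ^+ 2) / n v ^+ 3.

Let my i : measurable_fun setT (fun v => y v 0 i).
Proof. by apply: measurable_translate => j; exact: measurable_rowt. Qed.

Let mn : measurable_fun setT n.
Proof. exact: measurable_snorm. Qed.

Lemma measurable_stein_term i : measurable_fun setT (stein_term i).
Proof.
have mi : measurable_fun setT (fun v : p.-tuple R => tnth v i).
  exact: measurable_tnth.
apply: measurable_funD.
  apply: measurable_funB; first exact: measurableT_comp.
  by apply: measurable_funM => //; apply: measurable_funM => //; exact: measurable_funV.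
apply: measurable_funM; last by apply: measurable_funV; exact: measurable_funX.
by apply: measurable_funM => //; apply: measurable_funB; exact: measurable_funX.
Qed.

Let n0 v : 0 < n v. Proof. exact: snorm_gt0. Qed.

Let yn i v : y v 0 i ^+ 2 <= n v ^+ 2.
Proof.
rewrite sqr_snorm// /inner (bigD1 i)//= -expr2 -addrA lerDl addr_ge0 ?(ltW eps0)//.
by apply: sumr_ge0 => j _; rewrite -expr2 sqr_ge0.
Qed.

Lemma stein_term_ge0 i v : 0 <= stein_term i v.
Proof.
rewrite /stein_term addr_ge0//; last first.
  by rewrite divr_ge0 ?exprn_ge0 ?(ltW (n0 _))// mulr_ge0 ?subr_ge0.
rewrite subr_ge0 (le_trans (ler_norm _))// normrM ler_piMr// normrM normfV.
rewrite (gtr0_norm (n0 v)) ler_pdivrMr// mul1r.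
by rewrite -ler_sqr ?nnegrE ?(ltW (n0 v))// real_normK ?num_real.
Qed.

Lemma integral_stein_term i :
  (\int[G]_v (stein_term i v)%:E = (2 * gauss_cst R)%:E)%E.
Proof.
apply: (@ge0_integral_gauss_coord _ _ i) => [|v|v].
- by apply/measurable_EFinP; exact: measurable_stein_term.
- by rewrite lee_fin stein_term_ge0.
(* The part of n^2 that stays fixed while coordinate i varies. *)
pose q := \sum_(j < p | j != i) y v 0 j ^+ 2 + eps.
have q0 : 0 < q.
  by rewrite ltr_wpDl// sumr_ge0// => j _; rewrite sqr_ge0.
rewrite -(@stein_smooth_ratio (theta 0 i) s q)//; apply: eq_integral => x _.
congr EFin; rewrite /stein_term.
have yi : y (tupd R p v i x) 0 i = theta 0 i + s * x.
  by rewrite !mxE tnth_mktuple eqxx.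
have nE : n (tupd R p v i x) = Num.sqrt ((theta 0 i + s * x) ^+ 2 + q).
  rewrite /n /snorm /inner (bigD1 i)//= yi -expr2 -addrA; congr (Num.sqrt (_ + (_ + _))).
  by apply: eq_bigr => j ji; rewrite -expr2 !mxE tnth_mktuple (negbTE ji).
rewrite yi nE tnth_mktuple eqxx sqr_sqrtr; last first.
  by rewrite addr_ge0 ?sqr_ge0// ltW.
by rewrite (addrC _ q) addrK.
Qed.

End coordinates.

End gaussian_stein.

(** * Growth of the expected norm of a Gaussian vector *)

Section gaussian_growth.
Context (R : realType) (p : nat).
Local Notation G := (gauss_tuple R p).
Local Notation row := (rowt R p).
Implicit Types (theta : 'rV[R]_p) (s k eps D : R).

Lemma integral_gauss_abs_coord i :
  (\int[G]_v (`|tnth v i|)%:E = (2 * gauss_cst R)%:E)%E.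
Proof.
apply: (@ge0_integral_gauss_coord _ _ i) => [|v|v].
- apply/measurable_EFinP; apply: measurableT_comp => //; exact: measurable_tnth.
- by rewrite lee_fin.
under eq_integral do rewrite tnth_mktuple eqxx.
exact: integral_std_normal_norm.
Qed.

Lemma ge0_integral_sum_coord (b : R) (f : 'I_p -> p.-tuple R -> R) (c : R) :
  0 <= b -> (forall i, measurable_fun setT (f i)) -> (forall i v, 0 <= f i v) ->
  (forall i, \int[G]_v (f i v)%:E = c%:E)%E ->
  (\int[G]_v (b * \sum_i f i v)%:E = (b * (p%:R * c))%:E)%E.
Proof.
move=> b0 mf f0 fc.
under eq_integral do rewrite EFinM -sumEFin.
rewrite ge0_integralZl//; last 2 first.
- by apply: emeasurable_sum => i; exact/measurable_EFinP.
- by move=> v _; apply: sume_ge0 => i _; rewrite lee_fin.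
rewrite ge0_integral_sum//; last 2 first.
- by move=> i; exact/measurable_EFinP.
- by move=> i v _; rewrite lee_fin.
rewrite EFinM; congr (_ * _)%E.
rewrite (eq_bigr (fun=> c%:E)) => [|i _]; last exact: fc.
by rewrite sumEFin big_const_ord iter_addr_0 mulr_natl.
Qed.

Let mrow : forall i, measurable_fun setT (fun v => row v 0 i).
Proof. exact: measurable_rowt. Qed.

Lemma measurable_norm2_affine theta c :
  measurable_fun setT (fun v => norm2 (theta + c *: row v)).
Proof. by apply: measurable_norm2; exact: measurable_translate. Qed.

Lemma integral_gauss_norm2_lty theta c :
  (\int[G]_v (norm2 (theta + c *: row v))%:E < +oo)%E.
Proof.
have mt i : measurable_fun setT (fun v : p.-tuple R => `|tnth v i|).
  by apply: measurableT_comp => //; exact: measurable_tnth.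
apply: (@le_lt_trans _ _ (\int[G]_v ((norm2 theta)%:E + (`|c| * \sum_i `|tnth v i|)%:E))%E).
  apply: ge0_le_integral => //.
  - by move=> v _; rewrite lee_fin norm2_ge0.
  - by apply/measurable_EFinP; exact: measurable_norm2_affine.
  - apply: emeasurable_funD => //; apply/measurable_EFinP.
    by apply: measurable_funM => //; exact: measurable_sum.
  move=> v _; rewrite -EFinD lee_fin (le_trans (ler_norm2D _ _ _ _))// lerD2l norm2Z.
  rewrite ler_wpM2l// (le_trans (norm2_le_sum _ _ _))//.
  by apply: ler_sum => i _; rewrite mxE.
rewrite ge0_integralD//; last 3 first.
- by move=> v _; rewrite lee_fin norm2_ge0.
- by move=> v _; rewrite lee_fin mulr_ge0// sumr_ge0.
- by apply/measurable_EFinP; apply: measurable_funM => //; exact: measurable_sum.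
rewrite (ge0_integral_sum_coord _ _ (2 * gauss_cst R))//.
  by rewrite integral_gauss_cst -EFinD ltry.
exact: integral_gauss_abs_coord.
Qed.

(** With y the point with coefficient [k * s], the tangent inequality at y bounds the smoothed norm
    at coefficient [s] below by n + (1 - k) s <G, y> / n. The Stein terms trade <G, y> / n for the
    sum of |G_i| plus k s times the divergence of y / n, which is (p - 1) / n + eps / n^3. *)
Lemma sum_stein_term_ge theta s k eps v : 0 < eps -> 0 <= s -> 0 <= k <= 1 ->
  let n := snorm R p eps (theta + (k * s) *: row v) in
  n + (1 - k) * s * (k * s) * (p%:R - 1) * n^-1 + (1 - k) * s * \sum_i `|tnth v i| <=
  snorm R p eps (theta + s *: row v) +
    (1 - k) * s * \sum_i stein_term R p theta (k * s) eps i v.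
Proof.
move=> e0 s0 /andP[k0 k1]; cbv zeta.
set n := snorm R p eps (theta + (k * s) *: row v).
have n0 : 0 < n by exact: snorm_gt0.
have nn : n != 0 by rewrite gt_eqF.
have n2 : n ^+ 2 = inner (theta + (k * s) *: row v) (theta + (k * s) *: row v) + eps.
  exact: sqr_snorm.
rewrite /stein_term -/n !big_split /= sumrN.
set S := \sum_i `|_|.
have -> : \sum_i tnth v i * ((theta + (k * s) *: row v) 0 i / n) =
    inner (row v) (theta + (k * s) *: row v) / n.
  by rewrite mulr_suml; apply: eq_bigr => i _; rewrite mulrA [row v 0 i]mxE.
have -> : \sum_i k * s * (n ^+ 2 - (theta + (k * s) *: row v) 0 i ^+ 2) / n ^+ 3 =
   k * s * (p%:R * n ^+ 2 - (n ^+ 2 - eps)) / n ^+ 3.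
  rewrite -mulr_suml -mulr_sumr sumrB; congr (_ * (_ - _) / _).
    by rewrite sumr_const card_ord mulr_natl.
  by rewrite n2 addrK; apply: eq_bigr => i _; rewrite expr2.
have := snorm_convex R p eps (theta + (k * s) *: row v) (((1 - k) * s) *: row v) e0.
have -> : theta + (k * s) *: row v + ((1 - k) * s) *: row v = theta + s *: row v.
  by rewrite -addrA -scalerDl; congr (_ + _ *: _); ring.
rewrite innerZl -/n; move: (inner _ _) (snorm _ _ _ _) => I m nm.
(* The contribution of [eps] to the divergence, dropped in the bound. *)
have key : 0 <= (1 - k) * s * (k * s) * eps / n ^+ 3.
  by rewrite divr_ge0 ?exprn_ge0 ?(ltW n0)// !mulr_ge0 ?subr_ge0 ?(ltW e0).
rewrite -subr_ge0.
rewrite [leRHS](_ : _ = (m - (n + (1 - k) * s * I / n)) +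
  (1 - k) * s * (k * s) * eps / n ^+ 3).
  by rewrite addr_ge0// subr_ge0.
by field.
Qed.

(** In the integral of [sum_stein_term_ge], the absolute coordinates on one side and the Stein terms
    on the other have the same finite expectation, hence cancel. *)
Lemma snorm_gauss_growth theta s k eps : 0 < eps -> 0 <= s -> 0 <= k <= 1 ->
  (1 <= p)%N ->
  (\int[G]_v (snorm R p eps (theta + (k * s) *: row v))%:E +
   ((1 - k) * s * (k * s) * (p%:R - 1))%:E *
     \int[G]_v ((snorm R p eps (theta + (k * s) *: row v))^-1)%:E <=
   \int[G]_v (snorm R p eps (theta + s *: row v))%:E)%E.
Proof.
move=> e0 s0 k01 p1; set c := _ * (p%:R - 1).
have /andP[k0 k1] := k01.
have ks0 : 0 <= k * s by rewrite mulr_ge0.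
have b0 : 0 <= (1 - k) * s by rewrite mulr_ge0 ?subr_ge0.
have c0 : 0 <= c by rewrite !mulr_ge0 ?subr_ge0// ler1n.
have sn0 x : 0 <= snorm R p eps x by rewrite sqrtr_ge0.
have msn t : measurable_fun setT (fun v => snorm R p eps (theta + t *: row v)).
  by apply: measurable_snorm; exact: measurable_translate.
have mt i : measurable_fun setT (fun v : p.-tuple R => `|tnth v i|).
  by apply: measurableT_comp => //; exact: measurable_tnth.
have mst i : measurable_fun setT (stein_term R p theta (k * s) eps i).
  exact: measurable_stein_term.
have st0 i v : 0 <= stein_term R p theta (k * s) eps i v.
  exact: stein_term_ge0.
have main := @ae_ge0_le_integral2 _ _ _ G
  (fun v => (snorm R p eps (theta + (k * s) *: row v))%:E +
     (c * (snorm R p eps (theta + (k * s) *: row v))^-1)%:E)%E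
  (fun v => ((1 - k) * s * \sum_i `|tnth v i|)%:E)
  (fun v => (snorm R p eps (theta + s *: row v))%:E)
  (fun v => ((1 - k) * s * \sum_i stein_term R p theta (k * s) eps i v)%:E).
have {main} : (\int[G]_v ((snorm R p eps (theta + (k * s) *: row v))%:E +
     (c * (snorm R p eps (theta + (k * s) *: row v))^-1)%:E) +
     ((1 - k) * s * (p%:R * (2 * gauss_cst R)))%:E <=
     \int[G]_v (snorm R p eps (theta + s *: row v))%:E +
     ((1 - k) * s * (p%:R * (2 * gauss_cst R)))%:E)%E.
  rewrite -{1}(ge0_integral_sum_coord _ (fun i v => `|tnth v i|) (2 * gauss_cst R))//; last first.
    exact: integral_gauss_abs_coord.
  rewrite -(ge0_integral_sum_coord _ (stein_term R p theta (k * s) eps) (2 * gauss_cst R))//; last first.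
    by move=> i; exact: integral_stein_term.
  apply: main.
  - apply: emeasurable_funD; apply/measurable_EFinP => //.
    by apply: measurable_funM => //; exact: measurable_funV.
  - by apply/measurable_EFinP; apply: measurable_funM => //; exact: measurable_sum.
  - exact/measurable_EFinP.
  - by apply/measurable_EFinP; apply: measurable_funM => //; exact: measurable_sum.
  - by move=> v; apply: adde_ge0; rewrite lee_fin// mulr_ge0// invr_ge0.
  - by move=> v; rewrite lee_fin mulr_ge0// sumr_ge0.
  - by move=> v; rewrite lee_fin.
  - by move=> v; rewrite lee_fin mulr_ge0// sumr_ge0.
  - by apply: aeW => /= v; rewrite -!EFinD lee_fin; exact: sum_stein_term_ge.
rewrite leeD2rE// ge0_integralD//; last 4 first.
- by move=> v _; rewrite lee_fin.
- exact/measurable_EFinP.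
- by move=> v _; rewrite lee_fin mulr_ge0 ?invr_ge0.
- by apply/measurable_EFinP; apply: measurable_funM => //; exact: measurable_funV.
suff -> : (\int[G]_v (c * (snorm R p eps (theta + (k * s) *: row v))^-1)%:E =
  c%:E * \int[G]_v ((snorm R p eps (theta + (k * s) *: row v))^-1)%:E)%E by [].
under eq_integral do rewrite EFinM.
rewrite ge0_integralZl//.
- by apply/measurable_EFinP; exact: measurable_funV.
- by move=> v _; rewrite lee_fin invr_ge0.
Qed.

End gaussian_growth.

Section gaussian_norm_growth.
Context (R : realType) (p : nat).
Local Notation G := (gauss_tuple R p).
Local Notation row := (rowt R p).
Variables (theta : 'rV[R]_p) (s k D : R).
Hypothesis s0 : 0 <= s.
Hypothesis k01 : 0 <= k <= 1.
Hypothesis p1 : (1 <= p)%N.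
Hypothesis D0 : 0 < D.
Hypothesis thetaD : norm2 theta <= D.

Let K := (\int[G]_v ((D + s * norm2 (row v))^-1)%:E)%E.
Let c := (1 - k) * s * (k * s) * (p%:R - 1).

Let X0 v : D <= D + s * norm2 (row v).
Proof. by rewrite lerDl mulr_ge0 ?norm2_ge0. Qed.

Let Xp v : 0 < D + s * norm2 (row v).
Proof. exact: lt_le_trans (X0 v). Qed.

Let mX : measurable_fun setT (fun v => (D + s * norm2 (row v))^-1).
Proof.
apply: measurable_funV; apply: measurable_funD => //; apply: measurable_funM => //.
by apply: measurable_norm2; exact: measurable_rowt.
Qed.

Lemma gauss_inv_norm2_fin_num : K \is a fin_num.
Proof.
rewrite ge0_fin_numE; last first.
  by apply: integral_ge0 => v _; rewrite lee_fin invr_ge0 ltW.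
apply: (@le_lt_trans _ _ (\int[G]_v (D^-1)%:E)%E); last first.
  by rewrite integral_gauss_cst ltry.
apply: ge0_le_integral => //.
- by move=> v _; rewrite lee_fin invr_ge0 ltW.
- exact/measurable_EFinP.
- by move=> v _; rewrite lee_fin lef_pV2 ?posrE.
Qed.

Let c0 : 0 <= c.
Proof.
by have /andP[? ?] := k01; rewrite !mulr_ge0 ?subr_ge0// ler1n.
Qed.

(** With smoothing parameter e^2 the norm grows by at most e. The inverse loses at most the factor 1
    - e / D, because (1 - e / D) (X + e) <= X for X >= D. *)
Let growth_eps e : 0 < e -> e < D ->
  (\int[G]_v (norm2 (theta + (k * s) *: row v))%:E + (c * (1 - e / D))%:E * K <=
   \int[G]_v (norm2 (theta + s *: row v))%:E + e%:E)%E.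
Proof.
move=> e0 eD; have e20 : 0 < e ^+ 2 by rewrite exprn_gt0.
have /andP[k0 k1] := k01.
have msn t : measurable_fun setT (fun v => snorm R p (e ^+ 2) (theta + t *: row v)).
  by apply: measurable_snorm; apply: measurable_translate; exact: measurable_rowt.
have mn t := measurable_norm2_affine R p theta t.
have g0 : 0 <= 1 - e / D by rewrite subr_ge0 ler_pdivrMr// mul1r ltW.
apply: (@le_trans _ _ (\int[G]_v (snorm R p (e ^+ 2) (theta + s *: row v))%:E)%E); last first.
  rewrite -[X in (_ <= _ + X)%E](integral_gauss_cst R p) -ge0_integralD//; last 3 first.
  - by move=> v _; rewrite lee_fin norm2_ge0.
  - exact/measurable_EFinP.
  - by move=> v _; rewrite lee_fin ltW.
  apply: ge0_le_integral => //.
  - by move=> v _; rewrite lee_fin sqrtr_ge0.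
  - exact/measurable_EFinP.
  - by apply: emeasurable_funD => //; exact/measurable_EFinP.
  - by move=> v _; rewrite -EFinD lee_fin snorm_le_norm2.
apply: le_trans (snorm_gauss_growth R p theta s k (e ^+ 2) e20 s0 k01 p1).
rewrite -/c; apply: leeD.
  apply: ge0_le_integral => //.
  - by move=> v _; rewrite lee_fin norm2_ge0.
  - exact/measurable_EFinP.
  - exact/measurable_EFinP.
  - by move=> v _; rewrite lee_fin norm2_le_snorm.
rewrite EFinM -muleA lee_wpmul2l ?lee_fin// /K -ge0_integralZl//; last 2 first.
- exact/measurable_EFinP.
- by move=> v _; rewrite lee_fin invr_ge0 ltW.
apply: ge0_le_integral => //.
- by move=> v _; rewrite -EFinM lee_fin mulr_ge0// invr_ge0 ltW.
- by apply: emeasurable_funM => //; exact/measurable_EFinP.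
- by apply/measurable_EFinP; exact: measurable_funV.
move=> v _; rewrite -EFinM lee_fin.
have np : 0 < snorm R p (e ^+ 2) (theta + (k * s) *: row v) by exact: snorm_gt0.
rewrite ler_pdivrMr// [leRHS]mulrC ler_pdivlMr//.
have nX : snorm R p (e ^+ 2) (theta + (k * s) *: row v) <= D + s * norm2 (row v) + e.
  rewrite (le_trans (snorm_le_norm2 _ _ _ _ e0))// lerD2r.
  rewrite (le_trans (ler_norm2D _ _ _ _))// lerD// norm2Z ger0_norm ?mulr_ge0//.
  by rewrite -mulrA ler_piMl// mulr_ge0 ?norm2_ge0.
apply: le_trans (ler_wpM2l g0 nX) _.
have t0 : 0 <= e / D by rewrite divr_ge0 ?ltW.
have tX : e <= e / D * (D + s * norm2 (row v)).
  by rewrite -[leLHS](divfK (lt0r_neq0 D0)) ler_wpM2l.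
have te : 0 <= e / D * e by rewrite mulr_ge0// ltW.
by move: (e / D) tX te => t; move: (D + _) => x; lra.
Qed.

Lemma gauss_norm2_growth :
  (\int[G]_v (norm2 (theta + (k * s) *: row v))%:E + c%:E * K <=
   \int[G]_v (norm2 (theta + s *: row v))%:E)%E.
Proof.
have fn t : (\int[G]_v (norm2 (theta + t *: row v))%:E)%E \is a fin_num.
  rewrite ge0_fin_numE ?integral_gauss_norm2_lty//.
  by apply: integral_ge0 => v _; rewrite lee_fin norm2_ge0.
have K0 : (0 <= K)%E by apply: integral_ge0 => v _; rewrite lee_fin invr_ge0 ltW.
have H := growth_eps.
move: H K0; rewrite -(fineK (fn (k * s))) -(fineK (fn s)) -(fineK gauss_inv_norm2_fin_num).
move: (fine _) (fine _) (fine K) => a b x H; rewrite lee_fin => x0.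
rewrite -EFinM -EFinD lee_fin leNgt; apply/negP => lt.
(* The total error in [growth_eps] is e times this slope; e is then chosen so that it is at most
   half of the supposed gap. *)
pose M := 1 + c * x / D.
have cx : 0 <= c * x by apply: mulr_ge0 => //; exact: c0.
have M0 : 0 < M.
  apply: ltr_pwDl => //.
  by apply: divr_ge0 => //; exact: ltW.
pose e := Num.min (D / 2) ((b + c * x - a) / (2 * M)).
have e0 : 0 < e.
  by rewrite /e lt_min divr_gt0//= divr_gt0 ?subr_gt0 ?mulr_gt0.
have eD : e < D.
  by rewrite /e gt_min; apply/orP; left; move: D0; lra.
have eM : e * M <= (b + c * x - a) / 2.
  rewrite -ler_pdivlMr// /e ge_min; apply/orP; right.
  by rewrite invfM mulrA.
have := H e e0 eD; rewrite -EFinM -!EFinD lee_fin.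
have -> : c * (1 - e / D) * x = c * x - e * (c * x / D) by ring.
by move: eM; rewrite /M mulrDr mulr1; lra.
Qed.

End gaussian_norm_growth.

(** * The law of the norm of the Gaussian vector *)

Section chi_law.
Context (R : realType).
Local Notation mu := (@lebesgue_measure R).
Local Notation N := (std_normal R).
Local Open Scope ereal_scope.

(** Unnormalized density of the norm in dimension n + 1. The indicator makes it a function on the
    whole line, where affine substitutions apply directly. *)
Definition chi_weight (n : nat) (r : R) : R :=
  (\1_`]0%R, +oo[%classic r * (r ^+ n * expR (- r ^+ 2 / 2)))%R.

Lemma chi_weight_gt0 n r : (0 < r)%R ->
  chi_weight n r = (r ^+ n * expR (- r ^+ 2 / 2))%R.
Proof.
by move=> r0; rewrite /chi_weight indicE mem_set ?mul1r//= in_itv/= r0.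
Qed.

Lemma chi_weight_le0 n r : (r <= 0)%R -> chi_weight n r = 0%R.
Proof.
move=> r0; rewrite /chi_weight indicE memNset ?mul0r//= in_itv/= andbT.
by apply/negP; rewrite -leNgt.
Qed.

Lemma chi_weight_ge0 n r : (0 <= chi_weight n r)%R.
Proof.
have [r0|r0] := leP r 0%R; first by rewrite chi_weight_le0.
by rewrite chi_weight_gt0// mulr_ge0 ?exprn_ge0 ?expR_ge0// ltW.
Qed.

Lemma chi_weightS n r : chi_weight n.+1 r = (r * chi_weight n r)%R.
Proof. by rewrite /chi_weight exprS; ring. Qed.

Lemma measurable_gauss_exp : measurable_fun setT (fun x : R => expR (- x ^+ 2 / 2)).
Proof. exact: continuous_measurable_fun (@continuous_gauss R). Qed.

Lemma measurable_chi_weight n : measurable_fun setT (chi_weight n).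
Proof.
apply: measurable_funM; first exact: measurable_indic.
by apply: measurable_funM => //; exact: measurable_gauss_exp.
Qed.

Lemma chi_weight_scale n (h r : R) : (1 <= h)%R ->
  (chi_weight n r * expR (- r ^+ 2 * (h ^+ 2 - 1) / 2) =
   h ^- n * chi_weight n (h * r))%R.
Proof.
move=> h1; have h0 : (0 < h)%R by exact: lt_le_trans h1.
have [r0|r0] := leP r 0%R.
  by rewrite !chi_weight_le0 ?mul0r ?mulr0// pmulr_rle0.
rewrite !chi_weight_gt0 ?mulr_gt0// -[LHS]mulrA -expRD exprMn !mulrA mulVf ?mul1r; last first.
  by rewrite expf_neq0// gt_eqF.
by congr (_ * expR _)%R; field.
Qed.

Lemma chi_law_base : forall g : R -> \bar R,
  measurable_fun setT g -> (forall x, 0 <= g x) ->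
  \int[gauss_tuple R 1]_v g (norm2 (rowt R 1 v)) =
  (2 * gauss_cst R)%:E * \int[mu]_r ((chi_weight 0 r)%:E * g r).
Proof.
move=> g mg g0.
have mng : measurable_fun setT (fun v : 1.-tuple R => g (norm2 (rowt R 1 v))).
  apply: measurableT_comp => //; apply: measurable_norm2 => i.
  exact: measurable_rowt.
rewrite ge0_integral_gaussS//.
transitivity (\int[N]_x g `|x|%R).
  apply: eq_integral => x _.
  rewrite -[RHS](integral_gauss_cst R 0); apply: eq_integral => v _; congr g.
  by rewrite /norm2 big_ord1 mxE /= sqrtr_sqr.
have mgn : measurable_fun setT (fun x : R => g `|x|%R) by exact: measurableT_comp.
rewrite (@ge0_integral_normal_prob _ 0 1 (fun x => g `|x|%R))//.
have mP : measurable_fun setT (fun x : R => g `|x|%R * (normal_pdf 0 1 x)%:E).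
  apply: emeasurable_funM => //; apply/measurable_EFinP.
  exact: measurable_normal_pdf.
have P0 x : 0 <= g `|x|%R * (normal_pdf 0 1 x)%:E.
  by rewrite mule_ge0// lee_fin normal_pdf_ge0.
rewrite ge0_integral_lebesgue_half//.
have E : \int[mu]_(x in `[0%R, +oo[) (g `|x|%R * (normal_pdf 0 1 x)%:E) =
    (gauss_cst R)%:E * \int[mu]_r ((chi_weight 0 r)%:E * g r).
  rewrite -integral_itv_obnd_cbnd; last exact: measurable_funTS.
  rewrite -ge0_integralZl//; last 3 first.
  - by apply: emeasurable_funM => //; apply/measurable_EFinP; exact: measurable_chi_weight.
  - by move=> x _; rewrite mule_ge0// lee_fin chi_weight_ge0.
  - by rewrite lee_fin ltW// gauss_cst_gt0.
  rewrite [LHS]integral_mkcond; apply: eq_integral => x _; rewrite patchE.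
  case: ifPn => [|/negP xn].
    rewrite inE /= in_itv /= andbT => x0.
    rewrite gtr0_norm// std_pdf_expR chi_weight_gt0// expr0 mul1r EFinM.
    by rewrite muleC muleA.
  rewrite chi_weight_le0 ?mul0e ?mule0// leNgt; apply/negP => x0; apply: xn.
  by rewrite inE /= in_itv /= x0.
rewrite E [X in _ + X](_ : _ = (gauss_cst R)%:E * \int[mu]_r ((chi_weight 0 r)%:E * g r)).
  rewrite -ge0_muleDl ?lee_fin ?(ltW (gauss_cst_gt0 R))// -EFinD.
  by congr (_%:E * _); ring.
by rewrite -E; apply: eq_integral => x _; rewrite normrN !std_pdf_expR sqrrN.
Qed.

(** A substitute for polar coordinates. The new norm is sqrt (x^2 + r^2); setting x = r u turns it
    into h r with h = sqrt (1 + u^2). The factor r raises the exponent of the weight, and rescaling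
    r by h at fixed u separates the variables, leaving h^-(n+2) under a u-integral that need not be
    evaluated. *)
Lemma chi_law_step n (K : \bar R) : 0 <= K ->
  (forall g : R -> \bar R, measurable_fun setT g -> (forall x, 0 <= g x) ->
  \int[gauss_tuple R n.+1]_v g (norm2 (rowt R n.+1 v)) =
  K * \int[mu]_r ((chi_weight n r)%:E * g r)) ->
  forall g : R -> \bar R, measurable_fun setT g -> (forall x, 0 <= g x) ->
  \int[gauss_tuple R n.+2]_v g (norm2 (rowt R n.+2 v)) =
  K * (gauss_cst R)%:E * \int[mu]_u ((Num.sqrt (1 + u ^+ 2)%R ^- n.+2)%R)%:E *
    \int[mu]_r ((chi_weight n.+1 r)%:E * g r).
Proof.
move=> K0 IH g mg g0.
have c0 : 0 <= (gauss_cst R)%:E by rewrite lee_fin ltW// gauss_cst_gt0.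
have Kc0 : 0 <= K * (gauss_cst R)%:E by rewrite mule_ge0.
have w0 m r : 0 <= (chi_weight m r)%:E by rewrite lee_fin chi_weight_ge0.
have msqrt : measurable_fun setT (@Num.sqrt R).
  exact: continuous_measurable_fun (@sqrt_continuous R).
have mw m : measurable_fun setT (fun r => (chi_weight m r)%:E).
  by apply/measurable_EFinP; exact: measurable_chi_weight.
pose E (x : R) : R := expR (- x ^+ 2 / 2).
have E0 x : 0 <= (E x)%:E by rewrite lee_fin expR_ge0.
have mE : measurable_fun setT (fun x => (E x)%:E).
  by apply/measurable_EFinP; exact: measurable_gauss_exp.
have mng : measurable_fun setT (fun v : n.+2.-tuple R => g (norm2 (rowt R n.+2 v))).
  apply: measurableT_comp => //; apply: measurable_norm2 => i.
  exact: measurable_rowt.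
pose q (x r : R) := Num.sqrt (x ^+ 2 + r ^+ 2)%R.
have mq1 x : measurable_fun setT (q x).
  apply: (measurableT_comp msqrt); apply: measurable_funD => //.
have mq : measurable_fun setT (fun z : R * R => q z.1 z.2).
  apply: (measurableT_comp msqrt); apply: measurable_funD;
  by apply: measurable_funX.
have mgq : measurable_fun setT (fun z : R * R => g (q z.1 z.2)).
  exact: (measurableT_comp mg mq).
have mF : measurable_fun setT (fun z : R * R =>
    (chi_weight n z.2)%:E * g (q z.1 z.2)).
  apply: emeasurable_funM => //.
  exact: (measurableT_comp (mw n) measurable_snd).
have mFE : measurable_fun setT (fun z : R * R =>
    (E z.1)%:E * ((chi_weight n z.2)%:E * g (q z.1 z.2))).
  apply: emeasurable_funM => //.
  exact: (measurableT_comp mE measurable_fst).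
have mI : measurable_fun setT (fun x : R => \int[mu]_r ((chi_weight n r)%:E * g (q x r))).
  apply: (@measurable_fun_fubini_tonelli_F _ _ _ _ _ mu
    (fun z : R * R => (chi_weight n z.2)%:E * g (q z.1 z.2))) => //.
  by move=> z; rewrite mule_ge0.
have I0 x : 0 <= \int[mu]_r ((chi_weight n r)%:E * g (q x r)).
  by apply: integral_ge0 => r _; rewrite mule_ge0.
transitivity (\int[N]_x (K * \int[mu]_r ((chi_weight n r)%:E * g (q x r)))).
  rewrite ge0_integral_gaussS//; apply: eq_integral => x _.
  rewrite -(IH (fun r => g (q x r)))//; last exact: (measurableT_comp mg (mq1 x)).
  apply: eq_integral => v _; congr g.
  rewrite [LHS]norm2_rtail /q; congr (Num.sqrt (_ ^+ 2 + _ ^+ 2)%R); first by rewrite mxE.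
  congr norm2.
  by apply/rowP => i; rewrite !mxE tnthS.
rewrite (@ge0_integral_normal_prob _ 0 1 (fun x => K * \int[mu]_r ((chi_weight n r)%:E * g (q x r)))); last 2 first.
- exact: emeasurable_funM.
- by move=> x; rewrite mule_ge0.
transitivity (\int[mu]_x (K * (gauss_cst R)%:E * \int[mu]_r ((E x)%:E * ((chi_weight n r)%:E * g (q x r))))).
  apply: eq_integral => x _; rewrite [X in _ = _ * X]ge0_integralZl//; last 2 first.
  - apply: emeasurable_funM; [exact: mw|exact: (measurableT_comp mg (mq1 x))].
  - by move=> r _; rewrite mule_ge0.
  rewrite std_pdf_expR EFinM -!muleA; congr (K * _).
  by rewrite muleC -muleA.
rewrite [LHS]ge0_integralZl//; last 2 first.
- apply: (@measurable_fun_fubini_tonelli_F _ _ _ _ _ mu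
    (fun z : R * R => (E z.1)%:E * ((chi_weight n z.2)%:E * g (q z.1 z.2)))) => //.
  by move=> z; rewrite !mule_ge0.
- by move=> x _; apply: integral_ge0 => r _; rewrite !mule_ge0.
rewrite -[RHS]muleA; congr (_ * _).
rewrite (@fubini_tonelli _ _ _ _ _ mu mu (fun z : R * R => (E z.1)%:E * ((chi_weight n z.2)%:E * g (q z.1 z.2))))//; last first.
  by move=> z; rewrite !mule_ge0.
pose h (u : R) := Num.sqrt (1 + u ^+ 2)%R.
have h2 u : (h u ^+ 2 = 1 + u ^+ 2)%R by rewrite sqr_sqrtr// addr_ge0// sqr_ge0.
have h1 u : (1 <= h u)%R.
  by rewrite -[X in (X <= _)%R]sqrtr1 ler_wsqrtr// lerDl sqr_ge0.
have h0 u : (0 < h u)%R by exact: lt_le_trans (h1 u).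
have mh : measurable_fun setT h.
  by apply: (measurableT_comp msqrt); apply: measurable_funD => //; exact: measurable_funX.
transitivity (\int[mu]_r \int[mu]_u
    (((h u ^- n.+1) * chi_weight n.+1 (h u * r))%R%:E * g (h u * r)%R)).
  apply: eq_integral => r _ /=.
  have [r0|r0] := leP r 0%R.
    rewrite integral0_eq; last by move=> x _; rewrite chi_weight_le0// mul0e mule0.
    rewrite integral0_eq// => u _; rewrite chi_weight_le0 ?mulr0 ?mul0e//.
    by rewrite pmulr_rle0.
  have mEr : measurable_fun setT (fun x => (E x)%:E * ((chi_weight n r)%:E * g (q x r))).
    apply: emeasurable_funM => //; apply: emeasurable_funM => //.
    apply: (measurableT_comp mg); apply: (measurableT_comp msqrt).
    exact: measurable_funD.
  rewrite (@ge0_integral_affine _ r 0 (fun x => (E x)%:E * ((chi_weight n r)%:E * g (q x r))))//; last first.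
    by move=> x; rewrite !mule_ge0.
  rewrite -ge0_integralZl ?lee_fin ?(ltW r0)//; last 2 first.
  - by apply: (measurableT_comp mEr); exact: measurable_affine.
  - by move=> x _; rewrite !mule_ge0.
  apply: eq_integral => u _; rewrite addr0.
  have -> : q (r * u)%R r = (h u * r)%R.
    rewrite /q exprMn -{2}(mulr1 (r ^+ 2)%R) -mulrDr sqrtrM ?sqr_ge0//.
    by rewrite sqrtr_sqr gtr0_norm// mulrC addrC.
  rewrite !muleA -!EFinM; congr (_%:E * _).
  rewrite -chi_weight_scale// h2 chi_weightS mulrAC; congr (_ * _ * expR _)%R.
  by ring.
have mH : measurable_fun setT (fun z : R * R =>
    ((h z.2 ^- n.+1) * chi_weight n.+1 (h z.2 * z.1))%R%:E * g (h z.2 * z.1)%R).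
  have mh2 : measurable_fun setT (fun z : R * R => h z.2).
    exact: (measurableT_comp mh measurable_snd).
  have mhz : measurable_fun setT (fun z : R * R => (h z.2 * z.1)%R).
    by apply: measurable_funM.
  apply: emeasurable_funM; last exact: (measurableT_comp mg mhz).
  apply/measurable_EFinP; apply: measurable_funM.
    by apply: measurable_funV; exact: measurable_funX.
  exact: (measurableT_comp (measurable_chi_weight n.+1) mhz).
rewrite (@fubini_tonelli _ _ _ _ _ mu mu (fun z : R * R =>
    ((h z.2 ^- n.+1) * chi_weight n.+1 (h z.2 * z.1))%R%:E * g (h z.2 * z.1)%R))//; last first.
  move=> z; rewrite mule_ge0// lee_fin mulr_ge0 ?chi_weight_ge0// invr_ge0 exprn_ge0//.
  exact: ltW.
have mwg : measurable_fun setT (fun r => (chi_weight n.+1 r)%:E * g r).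
  by apply: emeasurable_funM; [exact: mw|exact: mg].
have wg0 r : 0 <= (chi_weight n.+1 r)%:E * g r by rewrite mule_ge0.
have mhV : measurable_fun setT (fun u => (h u ^- n.+2)%:E).
  by apply/measurable_EFinP; apply: measurable_funV; exact: measurable_funX.
rewrite -ge0_integralZr//; last by apply: integral_ge0 => r _.
apply: eq_integral => u _ /=.
rewrite (@ge0_integral_affine _ (h u) 0 (fun r => (chi_weight n.+1 r)%:E * g r))//.
rewrite muleA -EFinM -ge0_integralZl//.
- apply: eq_integral => r _; rewrite addr0 muleA -EFinM; congr ((_ * _)%:E * _).
  by rewrite -/(h u) (exprS (h u) n.+1) invfM mulrAC mulVf ?mul1r// gt_eqF// h0.
- by apply: (measurableT_comp mwg); exact: measurable_affine.
- by rewrite lee_fin mulr_ge0 ?invr_ge0 ?exprn_ge0// ltW.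
Qed.

Lemma chi_law n : exists2 K : \bar R, 0 <= K &
  forall g : R -> \bar R, measurable_fun setT g -> (forall x, 0 <= g x) ->
  \int[gauss_tuple R n.+1]_v g (norm2 (rowt R n.+1 v)) =
  K * \int[mu]_r ((chi_weight n r)%:E * g r).
Proof.
elim: n => [|n [K K0 IH]].
  exists (2 * gauss_cst R)%:E; last exact: chi_law_base.
  by rewrite lee_fin mulr_ge0// ltW// gauss_cst_gt0.
exists (K * (gauss_cst R)%:E * \int[mu]_u ((Num.sqrt (1 + u ^+ 2)%R ^- n.+2)%R)%:E).
  rewrite !mule_ge0 ?lee_fin ?(ltW (gauss_cst_gt0 R))//.
  by apply: integral_ge0 => u _; rewrite lee_fin invr_ge0 exprn_ge0 ?sqrtr_ge0.
exact: chi_law_step.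
Qed.

End chi_law.

(** * Gaussian moments on the half-line and the Gamma function *)

Section gamma_moments.
Context (R : realType).
Local Notation mu := (@lebesgue_measure R).

(** The substitution r = sqrt (2 t) has infinite slope at 0; it is carried out away from 0 and
    extended by this limit. *)
Lemma ge0_integral_oy_cvg (a : R^nat) (f : R -> \bar R) :
  (forall k, 0 < a k <= k.+1%:R^-1) -> nonincreasing_seq a ->
  measurable_fun setT f -> (forall x : R, (0 < x)%R -> (0 <= f x)%E) ->
  (\int[mu]_(x in `[a k, +oo[) f x @[k --> \oo] -->
   \int[mu]_(x in `]0%R, +oo[) f x)%E.
Proof.
move=> ak na mf f0.
have -> : `]0, +oo[%classic = \bigcup_k `[a k, +oo[%classic :> set R.
  apply/seteqP; split => x.
    rewrite itvoyEbigcup => -[k _] /=; rewrite add0r in_itv /= andbT => kx.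
    exists k => //=; rewrite in_itv /= andbT (le_trans _ kx)//.
    by have /andP[] := ak k.
  move=> [k _] /=; rewrite !in_itv /= !andbT; apply: lt_le_trans.
  by have /andP[] := ak k.
apply: ge0_nondecreasing_set_cvg_integral => //.
- move=> m n mn; rewrite subsetEset => x /=; rewrite !in_itv /= !andbT.
  by apply: le_trans; exact: na.
- by move=> i; exact: measurable_funTS.
- move=> i x /=; rewrite in_itv /= andbT => aix; apply: f0.
  by apply: lt_le_trans aix; have /andP[] := ak i.
Qed.

Let F (t : R) : R := Num.sqrt (2 * t).

Let F0 (t : R) : 0 < t -> 0 < F t.
Proof. by move=> t0; rewrite sqrtr_gt0 mulr_gt0. Qed.

Let is_derive_F (t : R) : 0 < t -> is_derive t 1 F (F t)^-1.
Proof.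
move=> t0; have t20 : 0 < 2 * t by rewrite mulr_gt0.
have d1 : is_derive t 1 (fun t : R => 2 * t) 2.
  rewrite (_ : (fun t : R => _) = (fun t : R => 2 *: t))//.
  by apply: is_derive_eq; rewrite /GRing.scale /= mulr1.
have h := @is_derive1_comp _ Num.sqrt _ t _ _ (is_derive1_sqrt t20) d1.
apply: (is_derive_eq h); rewrite -/(F t).
by have := F0 _ t0; move: (F t) => x x0; field; rewrite gt_eqF.
Qed.

Let dFE (t : R) : 0 < t -> derive1 F t = (F t)^-1.
Proof. by move=> t0; rewrite derive1E; have [] := is_derive_F _ t0. Qed.

Let cF (t : R) : 0 < t -> {for t, continuous F}.
Proof.
move=> t0; apply: differentiable_continuous; apply/derivable1_diffP.
by have [] := is_derive_F _ t0.
Qed.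

Let cFV (t : R) : 0 < t -> (F x)^-1 @[x --> t] --> (F t)^-1.
Proof. by move=> t0; apply: cvgV; [rewrite gt_eqF ?F0|exact: cF]. Qed.

Let Fy : F x @[x --> +oo%R] --> +oo%R.
Proof.
apply/cvgryPge => A; near=> t.
rewrite (le_trans (ler_norm _))// -sqrtr_sqr ler_wsqrtr//.
have t1 : 0 <= t by near: t; apply: nbhs_pinfty_ge; exact: num_real.
have tA : A ^+ 2 <= t by near: t; apply: nbhs_pinfty_ge; exact: num_real.
by lra.
Unshelve. all: by end_near. Qed.

Lemma ge0_integral_sqrt_subst (a : R) (W : R -> R) : 0 < a ->
  continuous W -> (forall x, 0 < x -> 0 <= W x) ->
  (\int[mu]_(x in `[Num.sqrt (2 * a), +oo[) (W x)%:E =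
   \int[mu]_(t in `[a, +oo[) (W (Num.sqrt (2 * t)) / Num.sqrt (2 * t))%:E)%E.
Proof.
move=> a0 cW W0.
rewrite -/(F a) (@increasing_ge0_integration_by_substitutiony _ F W a).
- apply: eq_integral => t /[!inE] /=; rewrite in_itv /= andbT => at_.
  have t0 := lt_le_trans a0 at_.
  by rewrite !fctE dFE.
- move=> x y; rewrite !in_itv /= !andbT => ax ay xy.
  rewrite ltr_sqrt ?ltr_pM2l// mulr_gt0//.
  exact: lt_trans (lt_le_trans a0 ax) xy.
- move=> t; rewrite in_itv /= andbT => at_; have t0 := lt_trans a0 at_.
  rewrite /continuous_at dFE//; apply: cvg_trans (cFV _ t0).
  apply: near_eq_cvg; near=> x; rewrite dFE//.
  by near: x; exact: lt_nbhsr.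
- apply/cvg_ex; exists (F a)^-1.
  apply: cvg_trans (cvg_at_right_filter (cFV _ a0)).
  apply: near_eq_cvg; near=> x.
  have ax : a < x by near: x; exact: nbhs_right_gt.
  by rewrite dFE// (lt_trans a0).
- apply/cvg_ex; exists 0.
  have : (F x)^-1 @[x --> +oo%R] --> 0.
    apply/gtr0_cvgV0 => //; near=> x; apply: F0.
    by near: x; apply: nbhs_pinfty_gt; exact: num_real.
  apply: cvg_trans; apply: near_eq_cvg; near=> x.
  have x0 : 0 < x by near: x; apply: nbhs_pinfty_gt; exact: num_real.
  by rewrite dFE.
- split; last by apply: cvg_at_right_filter; exact: cF.
  move=> t; rewrite in_itv /= andbT => at_.
  by have [] := is_derive_F _ (lt_trans a0 at_).
- exact: Fy.
- exact: continuous_subspaceT.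
- move=> x; rewrite in_itv /= andbT => h; apply: W0; exact: lt_trans (F0 _ a0) h.
Unshelve. all: by end_near. Qed.

Lemma integral_pow_gauss_Gamma n :
  (\int[mu]_(x in `]0%R, +oo[) (x ^+ n * expR (- x ^+ 2 / 2))%:E =
   \int[mu]_(t in `]0%R, +oo[)
     (2 `^ ((n%:R - 1) / 2) * (t `^ ((n%:R + 1) / 2 - 1) * expR (- t)))%:E)%E.
Proof.
pose W (x : R) := x ^+ n * expR (- x ^+ 2 / 2).
pose V (t : R) := 2 `^ ((n%:R - 1) / 2) * (t `^ ((n%:R + 1) / 2 - 1) * expR (- t)).
have cW : continuous W.
  move=> x; apply: cvgM; first exact: exprn_continuous.
  exact: continuous_gauss.
have mV : measurable_fun setT V.
  apply: measurable_funM => //; apply: measurable_funM.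
    exact: measurable_powR.
  by apply: measurableT_comp.
have k1 k : 0 < (k.+1%:R^-1 : R) by rewrite invr_gt0.
have kle k : (k.+1%:R^-1 : R) <= 1 by rewrite invf_le1// ler1n.
have ni : nonincreasing_seq (fun k => k.+1%:R^-1 : R).
  by move=> m k mk; rewrite lef_pV2 ?posrE// ler_nat.
have c1 := @ge0_integral_oy_cvg (fun k => k.+1%:R^-1) (fun x => (W x)%:E).
(* The cutoffs correspond under the substitution: sqrt (2 (a^2 / 2)) = a. *)
have c2 := @ge0_integral_oy_cvg (fun k => k.+1%:R^-1 ^+ 2 / 2) (fun x => (V x)%:E).
have {}c1 : (\int[mu]_(x in `[(k.+1%:R^-1)%R, +oo[) (W x)%:E @[k --> \oo] -->
   \int[mu]_(x in `]0%R, +oo[) (W x)%:E)%E.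
  apply: c1 => //.
  - by move=> k; rewrite k1 lexx.
  - by apply/measurable_EFinP; exact: continuous_measurable_fun.
  - by move=> x x0; rewrite lee_fin mulr_ge0 ?exprn_ge0 ?expR_ge0// ltW.
have {}c2 : (\int[mu]_(x in `[(k.+1%:R^-1 ^+ 2 / 2)%R, +oo[) (V x)%:E @[k --> \oo] -->
   \int[mu]_(x in `]0%R, +oo[) (V x)%:E)%E.
  apply: c2 => //.
  - move=> k; rewrite divr_gt0 ?exprn_gt0//=.
    have := k1 k; have := kle k; move: (k.+1%:R^-1) => x x1 x0; nra.
  - move=> m k mk; rewrite ler_pM2r ?invr_gt0// ler_pXn2r ?nnegrE ?(ltW (k1 _))//.
    exact: ni.
  - exact/measurable_EFinP.
  - by move=> x x0; rewrite lee_fin !mulr_ge0 ?powR_ge0 ?expR_ge0.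
suff E : (fun k : nat => \int[mu]_(x in `[(k.+1%:R^-1)%R, +oo[) (W x)%:E)%E =
    (fun k : nat => \int[mu]_(x in `[(k.+1%:R^-1 ^+ 2 / 2)%R, +oo[) (V x)%:E)%E.
  by rewrite E in c1; exact: (cvg_unique _ c1 c2).
apply/funext => k.
have a0 : 0 < (k.+1%:R^-1 ^+ 2 / 2 : R) by rewrite divr_gt0 ?exprn_gt0.
have E := @ge0_integral_sqrt_subst _ W a0 cW.
rewrite [X in `[X, +oo[%classic](_ : _ = Num.sqrt (2 * (k.+1%:R^-1 ^+ 2 / 2))); last first.
  by rewrite mulrC divfK// sqrtr_sqr gtr0_norm.
rewrite E; last by move=> x x0; rewrite mulr_ge0 ?exprn_ge0 ?expR_ge0// ltW.
apply: eq_integral => t /[!inE] /=; rewrite in_itv /= andbT => kt.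
have t0 : 0 < t := lt_le_trans a0 kt.
congr EFin; rewrite /W /V sqr_sqrtr ?mulr_ge0 ?ltW//.
have -> : - (2 * t) / 2 = - t by field.
rewrite mulrAC mulrA; congr (_ * _).
have -> : (n%:R + 1) / 2 - 1 = (n%:R - 1) / 2 :> R by field.
rewrite -powRM ?ltW// mulrC.
have t20 : 0 < 2 * t by rewrite mulr_gt0.
rewrite -powR12_sqrt ?ltW// -powR_mulrn ?powR_ge0// -powRrM -powRN mulrC.
rewrite -powRD; last by rewrite (gt_eqF t20) implybT.
by congr (_ `^ _); field.
Qed.

Local Open Scope ereal_scope.

Lemma integral_chi_weight n (g : R -> \bar R) :
  \int[mu]_r ((chi_weight R n r)%:E * g r) =
  \int[mu]_(r in `]0%R, +oo[) ((r ^+ n * expR (- r ^+ 2 / 2))%:E * g r).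
Proof.
rewrite [RHS]integral_mkcond; apply: eq_integral => x _; rewrite patchE.
case: ifPn => [|/negP xn].
  by rewrite inE /= in_itv /= andbT => x0; rewrite chi_weight_gt0.
rewrite chi_weight_le0 ?mul0e// leNgt; apply/negP => x0; apply: xn.
by rewrite inE /= in_itv /= x0.
Qed.

(** The integral [M n] of the overview in closed form. At n = p - 1 it is the denominator of
    [gamma_const] without the factor d. *)
Definition chi_moment n : R := (2 `^ ((n%:R - 1) / 2) * Gamma ((n%:R + 1) / 2))%R.

(** The constant function 1 in [chi_law] yields K M = 1. This forces the mass M to be finite and
    positive and identifies the unevaluated constant K as its inverse. *)
Lemma chi_normalized n : (0 < chi_moment n)%R /\
  \int[mu]_r (chi_weight R n r)%:E = (chi_moment n)%:E /\
  forall g : R -> \bar R, measurable_fun setT g -> (forall x, 0 <= g x) ->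
  (chi_moment n)%:E * \int[gauss_tuple R n.+1]_v g (norm2 (rowt R n.+1 v)) =
  \int[mu]_r ((chi_weight R n r)%:E * g r).
Proof.
have [K K0 law] := chi_law R n.
set M := \int[mu]_r (chi_weight R n r)%:E.
have M0 : 0 <= M by apply: integral_ge0 => r _; rewrite lee_fin chi_weight_ge0.
have KM : K * M = 1.
  rewrite -(integral_gauss_cst R n.+1 1) (law (cst 1))//; congr (_ * _).
  by apply: eq_integral => r _; rewrite mule1.
have Mfin : M \is a fin_num.
  rewrite ge0_fin_numE// lt_neqAle leey andbT; apply/eqP => My.
  move: KM; rewrite My; have [->|Kn0] := eqVneq K 0.
    by rewrite mul0e => -[] /esym/eqP; rewrite oner_eq0.
  by rewrite gt0_muley// lt0e Kn0.
have ME : M = (chi_moment n)%:E.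
  rewrite /chi_moment /Gamma /Rintegral /M.
  have Mfin' := Mfin; rewrite /M in Mfin'.
  have EM : \int[mu]_r (chi_weight R n r)%:E =
    (2 `^ ((n%:R - 1) / 2))%:E * \int[mu]_(t in `]0%R, +oo[)
      (t `^ ((n%:R + 1) / 2 - 1) * expR (- t))%:E.
    transitivity (\int[mu]_r ((chi_weight R n r)%:E * cst 1 r)).
      by apply: eq_integral => r _; rewrite mule1.
    rewrite integral_chi_weight.
    under eq_integral do rewrite mule1.
    rewrite integral_pow_gauss_Gamma.
    under eq_integral do rewrite EFinM.
    rewrite ge0_integralZl ?lee_fin ?powR_ge0//.
    - apply/measurable_EFinP; apply: measurable_funTS; apply: measurable_funM.
        exact: measurable_powR.
      by apply: measurableT_comp.
    - by move=> t _; rewrite lee_fin mulr_ge0 ?powR_ge0 ?expR_ge0.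
  (* [Gamma] is the [fine] part of an integral, so it has the intended value only once that integral
     is known to be finite; this follows from finiteness of M. *)
  rewrite EFinM fineK//.
  have I0 : 0 <= \int[mu]_(t in `]0%R, +oo[) (t `^ ((n%:R + 1) / 2 - 1) * expR (- t))%:E.
    by apply: integral_ge0 => t _; rewrite lee_fin mulr_ge0 ?powR_ge0 ?expR_ge0.
  rewrite ge0_fin_numE// lt_neqAle leey andbT; apply/eqP => Iy.
  move: Mfin'; rewrite EM Iy gt0_muley// lte_fin powR_gt0//.
have Mp : 0 < M.
  rewrite lt_neqAle M0 andbT eq_sym; apply/eqP => M_0.
  by move: KM; rewrite M_0 mule0 => -[] /esym/eqP; rewrite oner_eq0.
split; first by rewrite -lte_fin -ME.
split=> // g mg g0; rewrite law// -ME muleA (muleC M) KM mul1e//.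
Qed.

End gamma_moments.

(** The recursion unrolled down to [j 0] and multiplied by x. With q = p - 1 the left side is the
    numerator of [gamma_const]. *)
Lemma alternating_recursion_sum (R : comPzRingType) (m j : nat -> R) (x : R) q :
  (forall n, j n.+1 = m n - x * j n) ->
  \sum_(0 <= i < q) m i * (-1) ^+ (q.+1 - i) * x ^+ (q.+1 - 1 - i)
   - (- x) ^+ q.+1 * j 0 = x * j q.
Proof.
move=> jS; elim: q => [|q IH].
  by rewrite big_geq// expr1 add0r mulNr opprK.
rewrite big_nat_recr//= jS mulrBr -[in RHS]IH.
rewrite [X in X + _ + _](_ : _ = - x * \sum_(0 <= i < q)
    m i * (-1) ^+ (q.+1 - i) * x ^+ (q.+1 - 1 - i)); last first.
  rewrite mulr_sumr; apply: eq_big_nat => i /andP[_ iq].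
  rewrite !subn1 /= subSn; last by rewrite (leq_trans (ltnW iq)).
  by rewrite (subSn (ltnW iq)) !exprS; ring.
have -> : (q.+2 - q = 2)%N by rewrite !subSn// subnn.
have -> : (q.+2 - 1 - q = 1)%N by rewrite subn1 /= subSn// subnn.
by rewrite [(- x) ^+ q.+2]exprS; ring.
Qed.

(** * Identification of the constant gamma_p *)

Section gamma_constant.
Context (R : realType).
Local Notation mu := (@lebesgue_measure R).
Variable m : R.
Hypothesis m0 : 0 < m.
Local Open Scope ereal_scope.

(** The absolute value keeps the integrand nonnegative on the whole line; where the weight is
    nonzero, r is positive. *)
Let J n := \int[mu]_r ((chi_weight R n r)%:E * ((m + `|r|)^-1)%:E).

Let d0 (r : R) : (0 < m + `|r|)%R.
Proof. by rewrite ltr_pwDl. Qed.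

Let mV : measurable_fun setT (fun r : R => ((m + `|r|)^-1)%R%:E).
Proof.
by apply/measurable_EFinP; apply: measurable_funV; apply: measurable_funD.
Qed.

Let mJ n : measurable_fun setT (fun r => (chi_weight R n r)%:E * ((m + `|r|)^-1)%R%:E).
Proof.
by apply: emeasurable_funM => //; apply/measurable_EFinP; exact: measurable_chi_weight.
Qed.

Let J0 n r : 0 <= (chi_weight R n r)%:E * ((m + `|r|)^-1)%R%:E.
Proof. by rewrite -EFinM lee_fin mulr_ge0 ?chi_weight_ge0// invr_ge0 ltW. Qed.

Let J_recursion n : J n.+1 + m%:E * J n = (chi_moment R n)%:E.
Proof.
have [_ [<- _]] := chi_normalized R n.
rewrite /J -ge0_integralZl; [|by []|exact: mJ|by []|by rewrite lee_fin ltW].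
rewrite -ge0_integralD; [|by []|by []|exact: mJ| |].
- apply: eq_integral => r _; rewrite -!EFinM -EFinD; congr EFin.
  have [r0|r0] := leP r 0%R; first by rewrite !chi_weight_le0// !mul0r mulr0 addr0.
  rewrite chi_weightS gtr0_norm//.
  have : (m + r)%R != 0%R by rewrite gt_eqF// addr_gt0.
  by move=> h; field.
- by move=> r _; apply: mule_ge0 => //; rewrite lee_fin ltW.
- by apply: emeasurable_funM => //; exact: mJ.
Qed.

Let Jge0 n : 0 <= J n.
Proof. exact: integral_ge0. Qed.

Let J_fin n : J n \is a fin_num.
Proof.
rewrite ge0_fin_numE// lt_neqAle leey andbT; apply/eqP => Jy.
have := J_recursion n; rewrite Jy gt0_muley// addey//.
by rewrite gt_eqF// (lt_le_trans _ (Jge0 _)).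
Qed.

Definition chi_inv n : R := fine (J n).
Local Notation j := chi_inv.

Lemma chi_invS n : j n.+1 = (chi_moment R n - m * j n)%R.
Proof.
have := J_recursion n; rewrite -(fineK (J_fin n.+1)) -(fineK (J_fin n)).
by rewrite -EFinM -EFinD => -[<-]; rewrite addrK.
Qed.

Lemma chi_inv0 : j 0 = Ifun m.
Proof.
rewrite /j /J /Ifun /Rintegral; congr fine.
rewrite (integral_chi_weight _ 0 (fun r => ((m + `|r|)^-1)%R%:E)).
rewrite -integral_itv_obnd_cbnd; last first.
  apply/measurable_EFinP; apply: measurable_funTS; apply: measurable_funM.
    exact: measurable_gauss_exp.
  by apply: measurable_funV; apply: measurable_funD.
apply: eq_integral => r /[!inE] /=; rewrite in_itv /= andbT => r0.
by rewrite expr0 mul1r gtr0_norm// -EFinM.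
Qed.

Lemma integral_gauss_inv_mu n :
  \int[gauss_tuple R n.+1]_v ((m + norm2 (rowt R n.+1 v))^-1)%:E =
  (j n / chi_moment R n)%:E.
Proof.
have [M0 [_ H]] := chi_normalized R n.
have := H (fun r => ((m + `|r|)^-1)%R%:E) mV.
under eq_integral do rewrite ger0_norm ?norm2_ge0//.
move=> /(_ (fun x => ltac:(by rewrite lee_fin invr_ge0 ltW))).
rewrite -/(J n) -(fineK (J_fin n)) -/(j n) => E.
have fin : \int[gauss_tuple R n.+1]_v ((m + norm2 (rowt R n.+1 v))^-1)%:E \is a fin_num.
  rewrite ge0_fin_numE; last first.
    by apply: integral_ge0 => v _; rewrite lee_fin invr_ge0 addr_ge0 ?norm2_ge0// ltW.
  rewrite lt_neqAle leey andbT; apply/eqP => Jy.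
  by move: E; rewrite Jy gt0_muley.
move: E; rewrite -(fineK fin) -EFinM => -[<-].
by congr EFin; rewrite mulrC mulKf// gt_eqF.
Qed.

End gamma_constant.

(** Factoring out sqrt a reduces the expectation to [integral_gauss_inv_mu] with m = d / sqrt a. The
    unrolled recursion carries an extra factor m, and m / d is the missing 1 / sqrt a. *)
Lemma gamma_constE (R : realType) q (d a : R) : 0 < d -> 0 < a ->
  (\int[gauss_tuple R q.+1]_v ((d + Num.sqrt a * norm2 (rowt R q.+1 v))^-1)%:E =
   (gamma_const q.+1 d a)%:E)%E.
Proof.
move=> d0 a0; set sa := Num.sqrt a.
have sa0 : 0 < sa by rewrite sqrtr_gt0.
pose m := d / sa; have m0 : 0 < m by rewrite divr_gt0.
transitivity ((sa^-1)%:E * \int[gauss_tuple R q.+1]_v ((m + norm2 (rowt R q.+1 v))^-1)%:E)%E.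
  rewrite -ge0_integralZl//; last 3 first.
  - apply/measurable_EFinP; apply: measurable_funV; apply: measurable_funD => //.
    by apply: measurable_norm2; exact: measurable_rowt.
  - by move=> v _; rewrite lee_fin invr_ge0 addr_ge0 ?norm2_ge0// ltW.
  - by rewrite lee_fin invr_ge0 ltW.
  apply: eq_integral => v _; rewrite -EFinM -invfM; congr (_^-1)%:E.
  by rewrite /m; field; rewrite gt_eqF.
rewrite integral_gauss_inv_mu// -EFinM; congr EFin.
rewrite /gamma_const -/sa -/m /=.
have [M0 _] := chi_normalized R q.
have -> : q.+1%:R / 2 - 1 = (q%:R - 1) / 2 :> R by rewrite -natr1; field.
have -> : q.+1%:R / 2 = (q%:R + 1) / 2 :> R by rewrite -natr1.
rewrite -/(chi_moment R q).
rewrite -(chi_inv0 _ m) [X in X - _](_ : _ = \sum_(0 <= i < q)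
    chi_moment R i * (-1) ^+ (q.+1 - i) * m ^+ (q.+1 - 1 - i)); last first.
  by apply: eq_bigr => i _; rewrite /chi_moment; ring.
rewrite (alternating_recursion_sum _ _ (chi_inv R m))//; last first.
  by move=> n; exact: chi_invS.
by rewrite /m; field; rewrite !gt_eqF.
Qed.

Lemma continuous_sumr (R : realType) (T : topologicalType) (I : Type) (r : seq I)
    (f : I -> T -> R) :
  (forall i, continuous (f i)) -> continuous (fun x => \sum_(i <- r) f i x).
Proof.
move=> cf x; elim: r => [|i r IH].
  rewrite (_ : (fun x => _) = cst 0); first exact: cst_continuous.
  by apply/funext => y; rewrite big_nil.
rewrite (_ : (fun x => _) = (f i + fun x => \sum_(i <- r) f i x)).
  by apply: continuousD => //; exact: cf.
by apply/funext => y; rewrite big_cons.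
Qed.

(** * Extreme eigenvalues and the Rayleigh quotient *)

Section rayleigh.
Context (R : realType) (p : nat).
Implicit Types (A : 'M[R]_p) (u v t : 'rV[R]_p).

Lemma qform_inner A t : qform A t = inner (t *m A) t.
Proof. by rewrite /qform mxE; apply: eq_bigr => i _; rewrite [t^T _ _]mxE. Qed.

Lemma inner_mulmx A u v : inner (u *m A) v = inner u (v *m A^T).
Proof.
rewrite /inner; under eq_bigr do rewrite mxE mulr_suml.
rewrite exchange_big /=; apply: eq_bigr => i _; rewrite mxE mulr_sumr.
by apply: eq_bigr => j _; rewrite mxE mulrA mulrAC -!mulrA.
Qed.

Lemma continuous_inner_self : continuous (fun v => inner v v).
Proof.
apply: continuous_sumr => i v.
by apply: (@continuousM _ _ (fun v => v 0 i) (fun v => v 0 i)); exact: (@coord_continuous R 1 p 0 i).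
Qed.

Lemma continuous_qform A : continuous (qform A).
Proof.
rewrite (_ : qform A = fun v => \sum_i (\sum_k v 0 k * A k i) * v 0 i).
  apply: continuous_sumr => i v.
  apply: (@continuousM _ _ (fun v => \sum_k v 0 k * A k i) (fun v => v 0 i)); last first.
    exact: (@coord_continuous R 1 p 0 i).
  move: v; apply: continuous_sumr => k v.
  apply: (@continuousM _ _ (fun v => v 0 k) (cst (A k i))); last exact: cst_continuous.
  exact: (@coord_continuous R 1 p 0 k).
by apply/funext => t; rewrite qform_inner; apply: eq_bigr => i _; rewrite mxE.
Qed.

Lemma compact_sphere : compact [set v : 'rV[R]_p | inner v v = 1].
Proof.
apply: bounded_closed_compact; last first.
  rewrite (_ : [set v | _] = (fun v => inner v v) @^-1` [set 1])//.
  apply: closed_comp; last exact: closed_eq.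
  by move=> x _; exact: continuous_inner_self.
exists 1; split=> // M M1 v /= v1.
apply: le_trans (ltW M1).
have -> : `|v| = mx_norm v by [].
rewrite mx_normrE; apply/bigmax_leP; split=> // -[i j] _ /=.
rewrite (ord1 i) -(@expr_le1 _ 2)// real_normK ?num_real// -v1 /inner (bigD1 j)//= -expr2.
by rewrite lerDl; apply: sumr_ge0 => k _; rewrite -expr2 sqr_ge0.
Qed.

(** The quadratic form attains its minimum l on the unit sphere, and first-order optimality makes
    the minimizer an eigenvector. Existence of a real eigenvalue also ensures that [lambda_min] is
    an infimum over a nonempty set. *)
Lemma rayleigh_min A : (0 < p)%N -> A^T = A ->
  exists2 l : R, eigenvalue A l & forall t, l * inner t t <= qform A t.
Proof.
move=> p0 symA.
have S0 : [set v : 'rV[R]_p | inner v v = 1] !=set0.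
  exists (delta_mx 0 (Ordinal p0)); rewrite /= /inner (bigD1 (Ordinal p0))//= mxE !eqxx mulr1.
  rewrite big1 ?addr0// => i ip; rewrite mxE (negbTE ip) andbF mul0r//.
have [c] := compact_EVT_min S0 compact_sphere (continuous_subspaceT (continuous_qform A)).
rewrite inE /= => c1 cmin.
pose l := qform A c.
have lmin t : l * inner t t <= qform A t.
  have [t0|t0] := eqVneq (inner t t) 0.
    by rewrite t0 mulr0 (inner_eq0 _ _ _ t0) qform_inner inner0r.
  have tp : 0 < inner t t by rewrite lt_def t0 inner_ge0.
  have np : 0 < norm2 t.
    rewrite lt_def norm2_ge0 andbT; apply/eqP => n0.
    by move: t0; rewrite -sqr_norm2 n0 expr0n eqxx.
  have := cmin ((norm2 t)^-1 *: t).
  rewrite inE /= innerZl innerZr mulrA -expr2 exprVn sqr_norm2 mulVf//.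
  move=> /(_ erefl); rewrite -/l [X in _ <= X]qform_inner -scalemxAl innerZl innerZr.
  by rewrite mulrA -expr2 exprVn sqr_norm2 -qform_inner mulrC ler_pdivlMr.
exists l => //; apply/eigenvalueP; exists c; last first.
  apply/eqP => c0; move: c1; rewrite c0 inner0r => /esym/eqP; exact/negP/oner_neq0.
(* The residual of the eigenvalue equation, also used as the direction of perturbation: the first
   variation along it is 2 |g|^2. *)
pose g := c *m A - l *: c.
suff g0 : g = 0 by apply/eqP; rewrite -subr_eq0 -/g g0.
apply: (inner_eq0 R p); pose a := qform A g - l * inner g g.
have a0 : 0 <= a by rewrite subr_ge0.
pose b := inner g g; have b0 : 0 <= b by exact: inner_ge0.
have bE : inner (c *m A) g - l * inner c g = b.
  have -> : b = inner (c *m A - l *: c) g by [].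
  by rewrite innerDl -(scaleNr l c) innerZl mulNr.
have H e : 0 <= 2 * e * b + e ^+ 2 * a.
  have := lmin (c + e *: g); rewrite -subr_ge0 qform_inner mulmxDl -scalemxAl.
  rewrite !(innerDl, innerDr) !(innerZl, innerZr) (inner_mulmx A g c) symA.
  rewrite (innerC _ _ g (c *m A)) (innerC _ _ g c) -!qform_inner -/l c1 /a -bE.
  by move: (inner (c *m A) g) (inner c g) (qform A g) (inner g g) => x y z w; lra.
(* The denominator a + 1 stays positive when a = 0; the value obtained is - b^2 (a + 2) / (a + 1)^2,
   which forces b = 0. *)
have := H (- b / (a + 1)).
have a1 : 0 < a + 1 by rewrite ltr_wpDl.
rewrite (_ : _ + _ = - (b ^+ 2 * (a + 2) / (a + 1) ^+ 2)); last by field; rewrite gt_eqF.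
rewrite oppr_ge0 => h; apply/eqP; rewrite -/b.
have : b ^+ 2 * (a + 2) / (a + 1) ^+ 2 == 0.
  rewrite eq_le h /=; apply: divr_ge0; last exact: sqr_ge0.
  by apply: mulr_ge0; [exact: sqr_ge0|rewrite addr_ge0].
rewrite !mulf_eq0 invr_eq0 !expf_eq0 /= (gt_eqF a1) orbF.
have a2 : 0 < a + 2 by rewrite ltr_wpDl.
by rewrite (gt_eqF a2) orbF orbb.
Qed.

Lemma eigenvalue_qform A a : eigenvalue A a ->
  exists2 v, 0 < inner v v & qform A v = a * inner v v.
Proof.
move=> /eigenvalueP[v vA v0]; exists v; last by rewrite qform_inner vA innerZl.
rewrite lt_def inner_ge0 andbT; apply/eqP => vv0.
by move: v0; rewrite (inner_eq0 _ _ _ vv0) eqxx.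
Qed.

Section posdef.
Variables (A : 'M[R]_p) (pA : posdef A).
Hypothesis p0 : (0 < p)%N.

Lemma posdef_eigenvalue_gt0 a : eigenvalue A a -> 0 < a.
Proof.
move=> /eigenvalue_qform[v v0 Av]; have [_ /(_ v)] := pA.
rewrite Av pmulr_lgt0//; apply; apply/eqP => vz.
by move: v0; rewrite vz inner0r ltxx.
Qed.

Lemma lambda_min_qform (lam : R) t :
  lam <= lambda_min A -> lam * inner t t <= qform A t.
Proof.
have [symA _] := pA; have [l el lmin] := rayleigh_min A p0 symA => lamA.
apply: le_trans (lmin t); rewrite ler_wpM2r ?inner_ge0// (le_trans lamA)//.
by apply: ge_inf => //; exists 0 => a /= /posdef_eigenvalue_gt0/ltW.
Qed.

Lemma lambda_min_le_max : lambda_min A <= lambda_max A.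
Proof.
have [symA _] := pA; have [l el lmin] := rayleigh_min A p0 symA.
have symN : (- A)^T = - A.
  by apply/matrixP => i j; rewrite !mxE -[in LHS]symA mxE.
(* The minimum for [- A] bounds the eigenvalues of [A] from above, so that the supremum [lambda_max]
   is a genuine one. *)
have [l' _ lmin'] := rayleigh_min (- A) p0 symN.
apply: (@le_trans _ _ l).
  by apply: ge_inf => //; exists 0 => a /= /posdef_eigenvalue_gt0/ltW.
apply: ub_le_sup => //; exists (- l') => a /= /eigenvalue_qform[v v0 Av].
have := lmin' v; rewrite qform_inner mulmxN -scaleN1r innerZl -qform_inner Av mulN1r -mulNr.
by rewrite ler_pM2r// lerNr.
Qed.

End posdef.

End rayleigh.

(** The integral of a nonnegative function is a supremum over simple functions below it, hence
    monotone whether or not the functions are measurable. *)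
Lemma ge0_le_integral_nonmeasurable d (T : measurableType d) (R : realType)
    (mu : {measure set T -> \bar R}) (f g : T -> \bar R) :
  (forall x, 0 <= f x)%E -> (forall x, f x <= g x)%E ->
  (\int[mu]_x f x <= \int[mu]_x g x)%E.
Proof.
move=> f0 fg; have g0 x : (0 <= g x)%E := le_trans (f0 x) (fg x).
rewrite !ge0_integralTE//; apply: ereal_sup_le => y [h /= hf hy].
by exists h => // x; exact: le_trans (hf x) (fg x).
Qed.

(** [f] is compared with c times the indicator of a set of full measure, so no measurability of [f]
    is asked. It is applied to [lambda_max (D w)]. *)
Lemma ae_ge_integral d (T : measurableType d) (R : realType) (P : probability T R)
    (c : R) (f : T -> R) :
  0 <= c -> (forall w, 0 <= f w) -> {ae P, forall w, c <= f w} ->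
  (c%:E <= \int[P]_w (f w)%:E)%E.
Proof.
move=> c0 f0 [N [mN PN fN]].
have PC : P (~` N) = 1%E.
  have := probability_setC P mN; rewrite -/(P N) => ->.
  by rewrite [X in (1 - X)%E](_ : _ = 0%E) ?sube0//; exact: PN.
have -> : c%:E = (\int[P]_w (c%:E * (\1_(~` N) w)%:E))%E.
  rewrite ge0_integralZl//; last by apply/measurable_EFinP; apply: measurable_indic; exact: measurableC.
  rewrite integral_indic//; last exact: measurableC.
  by rewrite [X in (_ * X)%E](_ : _ = 1%E) ?mule1// setIT; exact: PC.
apply: ge0_le_integral_nonmeasurable => w.
  by rewrite -EFinM lee_fin mulr_ge0.
rewrite -EFinM lee_fin indicE; case: (boolP (w \in ~` N)) => [|_]; rewrite ?mulr0 ?mulr1//.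
rewrite inE => wN; apply: contrapT => nfw; apply: wN; exact: fN.
Qed.

Section integral_combination.
Context d (T : measurableType d) (R : realType) (P : probability T R).

Lemma integral_affine_combination (f g : T -> R) (a b : R) :
  P.-integrable setT (EFin \o f) -> P.-integrable setT (EFin \o g) ->
  (\int[P]_w (f w + a * g w + b)%:E =
   \int[P]_w (f w)%:E + a%:E * \int[P]_w (g w)%:E + b%:E)%E.
Proof.
move=> fi gi.
have agi : P.-integrable setT (fun w => a%:E * (g w)%:E)%E by exact: integrableZl.
have bi : P.-integrable setT (fun=> b%:E).
  by apply: finite_measure_integrable_cst.
transitivity (\int[P]_w ((f w)%:E + a%:E * (g w)%:E + b%:E))%E.
  by apply: eq_integral => w _; rewrite EFinD EFinD EFinM.
rewrite integralD//; last exact: integrableD.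
rewrite integralD// integralZl//; congr (_ + _)%E.
rewrite integral_cst// [X in (_ * X)%E](_ : _ = 1%E) ?mule1//.
exact: (probability_setT P).
Qed.

Lemma integrable_le_cst (f g : T -> R) (b : R) :
  measurable_fun setT f -> P.-integrable setT (EFin \o g) ->
  (forall w, `|f w| <= b + g w) -> P.-integrable setT (EFin \o f).
Proof.
move=> mf gi fg.
have bi : P.-integrable setT (fun=> b%:E).
  by apply: finite_measure_integrable_cst.
apply: (le_integrable measurableT _ _ (integrableD measurableT bi gi)).
  exact/measurable_EFinP.
by move=> w _ /=; rewrite lee_fin; apply: le_trans (fg w) (ler_norm _).
Qed.

End integral_combination.

Lemma le_of_forall_lt1 (R : realFieldType) (c z : R) : 0 <= c ->
  (forall k, 0 < k -> k < 1 -> k * c <= z) -> c <= z.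
Proof.
move=> c0 H; rewrite leNgt; apply/negP => zc.
have z0 : 0 <= z.
  have := H 2^-1; rewrite invr_gt0 ltr0n invf_lt1 ?ltr0n// ltr1n => /(_ isT isT).
  by apply: le_trans; rewrite mulr_ge0// invr_ge0.
have cp : 0 < c by exact: le_lt_trans zc.
(* This k satisfies k c = (z + c) / 2, the midpoint, which exceeds z. *)
have := H ((z + c) / (2 * c)).
rewrite divr_gt0 ?mulr_gt0 ?ltr_wpDl// ltr_pdivrMr ?mulr_gt0// mul1r.
move=> /(_ isT); have -> : (z + c) / (2 * c) * c = (z + c) / 2 by field; rewrite gt_eqF.
move=> h; have zc2 : z + c < 2 * c by lra.
by have := h zc2; lra.
Qed.

(** * Pointwise bounds and risk of the shrinkage estimator *)

Section shrinkage.
Context d (T : measurableType d) (R : realType) (P : probability T R) (p : nat).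
Variables (theta : 'rV[R]_p) (xi : T -> 'rV[R]_p).
Hypothesis mxi : forall i, measurable_fun setT (fun w => xi w 0 i).
Hypothesis xi2 : (\int[P]_w (norm2 (xi w) ^+ 2)%:E < +oo)%E.
Let Y w := theta + xi w.
Let Z w := inner (xi w) (Y w) / norm2 (Y w).

Let mY i : measurable_fun setT (fun w => Y w 0 i).
Proof. by under eq_fun do rewrite mxE; exact: measurable_funD. Qed.

Let mZ : measurable_fun setT Z.
Proof.
apply: measurable_funM; first exact: measurable_inner.
by apply: measurable_funV; exact: measurable_norm2.
Qed.

Let xi2i : P.-integrable setT (EFin \o (fun w => norm2 (xi w) ^+ 2)).
Proof.
apply/integrableP; split.
  by apply/measurable_EFinP; apply: measurable_funX; exact: measurable_norm2.
apply: le_lt_trans xi2; apply: ge0_le_integral => //.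
- apply: measurableT_comp => //; apply/measurable_EFinP.
  by apply: measurable_funX; exact: measurable_norm2.
- by apply/measurable_EFinP; apply: measurable_funX; exact: measurable_norm2.
- by move=> w _ /=; rewrite lee_fin ger0_norm// sqr_ge0.
Qed.

Let norm_le_sq (u : 'rV[R]_p) : norm2 u <= 1 + norm2 u ^+ 2.
Proof. by have := norm2_ge0 _ _ u; move: (norm2 u) => x x0; nra. Qed.

Let Z_le w : `|Z w| <= norm2 (xi w).
Proof.
rewrite /Z normrM normfV (ger0_norm (norm2_ge0 _ _ _)).
have [Y0|Yn0] := eqVneq (norm2 (Y w)) 0; first by rewrite Y0 invr0 mulr0 norm2_ge0.
have Yp : 0 < norm2 (Y w) by rewrite lt_def Yn0 norm2_ge0.
rewrite ler_pdivrMr// ler_norml inner_le_norm2 andbT lerNl.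
have := inner_le_norm2 R p (- 1 *: xi w) (Y w).
by rewrite innerZl mulN1r norm2Z normrN1 mul1r.
Qed.

Lemma integrable_shrink : P.-integrable setT (EFin \o Z).
Proof.
apply: (@integrable_le_cst _ _ _ P _ _ 1 mZ xi2i) => w.
exact: le_trans (Z_le w) (norm_le_sq _).
Qed.

Lemma integrable_norm2_translate k : 0 <= k <= 1 ->
  P.-integrable setT (EFin \o (fun w => norm2 (theta + k *: xi w))).
Proof.
move=> /andP[k0 k1]; apply: (@integrable_le_cst _ _ _ P _ _ (norm2 theta + 1) _ xi2i).
  by apply: measurable_norm2; exact: measurable_translate.
move=> w; rewrite ger0_norm ?norm2_ge0// (le_trans (ler_norm2D _ _ _ _))//.
rewrite -addrA lerD2l norm2Z ger0_norm//.
by apply: le_trans (norm_le_sq _); rewrite ler_piMl ?norm2_ge0.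
Qed.

(** Cauchy-Schwarz against Y / ||Y||. At Y = 0 the convention 0^-1 = 0 gives Z = 0 and the bound is
    trivial. The summand 0 matches the shape of [integral_affine_combination]. *)
Lemma norm2_le_shrink k w : 0 <= k <= 1 ->
  norm2 (Y w) <= norm2 (theta + k *: xi w) + (1 - k) * Z w + 0.
Proof.
move=> k01; rewrite addr0 /Z.
have [Y0|Yn0] := eqVneq (norm2 (Y w)) 0.
  by rewrite Y0 invr0 mulr0 mulr0 addr0 norm2_ge0.
have Yp : 0 < norm2 (Y w) by rewrite lt_def Yn0 norm2_ge0.
have := inner_le_norm2 R p (theta + k *: xi w) (Y w).
rewrite -ler_pdivrMr// => h; rewrite -lerBlDr; apply: le_trans h.
have -> : theta + k *: xi w = Y w + (- (1 - k)) *: xi w.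
  by rewrite /Y -addrA; congr (_ + _); rewrite -[X in X + _]scale1r -scalerDl; congr (_ *: _); ring.
rewrite innerDl innerZl -(sqr_norm2 _ _ (Y w)).
by move: (inner _ _) (norm2 _) Yn0 => i n n0; rewrite le_eqVlt; apply/orP; left; apply/eqP; field.
Qed.

(** An equality wherever Y is nonzero. At Y = 0 the convention 0^-1 = 0 makes the loss ||xi||^2,
    which leaves c^2 to spare. *)
Lemma shrink_sqr_le (c : R) w :
  norm2 ((1 - c / norm2 (Y w)) *: Y w - theta) ^+ 2 <=
  norm2 (xi w) ^+ 2 + (- 2 * c) * Z w + c ^+ 2.
Proof.
have E : (1 - c / norm2 (Y w)) *: Y w - theta = xi w + (- (c / norm2 (Y w))) *: Y w.
  rewrite scalerBl scale1r scaleNr addrAC; congr (_ + _).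
  by rewrite /Y addrAC subrr add0r.
rewrite {}E /Z; have [Y0|Yn0] := eqVneq (norm2 (Y w)) 0.
  by rewrite Y0 invr0 !mulr0 oppr0 scale0r !addr0 lerDl sqr_ge0.
move: (Y w) Yn0 => y Yn0.
rewrite !sqr_norm2 innerDl !innerDr !innerZl !innerZr (innerC _ _ y (xi w)) -(sqr_norm2 _ _ y).
move: (inner _ _) (inner _ _) (norm2 _) Yn0 => i j n n0.
by rewrite le_eqVlt; apply/orP; left; apply/eqP; field.
Qed.

Lemma shrink_risk (c : R) :
  0 <= c -> (c%:E <= \int[P]_w (Z w)%:E)%E ->
  (\int[P]_w (norm2 ((1 - c / norm2 (Y w)) *: Y w - theta) ^+ 2)%:E
   - \int[P]_w (norm2 (Y w - theta) ^+ 2)%:E <= - (c ^+ 2)%:E)%E.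
Proof.
move=> c0 cZ.
have -> : (\int[P]_w (norm2 (Y w - theta) ^+ 2)%:E = \int[P]_w (norm2 (xi w) ^+ 2)%:E)%E.
  by apply: eq_integral => w _; rewrite /Y addrC addKr.
have fx := integrable_fin_num measurableT xi2i.
have fz := integrable_fin_num measurableT integrable_shrink.
have := @ge0_le_integral_nonmeasurable _ _ _ P
  (fun w => (norm2 ((1 - c / norm2 (Y w)) *: Y w - theta) ^+ 2)%:E)
  (fun w => (norm2 (xi w) ^+ 2 + (- 2 * c) * Z w + c ^+ 2)%:E).
move=> /(_ (fun w => sqr_ge0 _) (fun w => shrink_sqr_le c w)).
rewrite (integral_affine_combination _ _ _ P _ _ _ _ xi2i integrable_shrink).
rewrite /= in fx fz; move: cZ; rewrite -(fineK fx) -(fineK fz) lee_fin.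
move: (fine _) (fine _) => x z cz H.
rewrite leeBlDr//; apply: le_trans H _.
rewrite -EFinM -!EFinD lee_fin.
have h : c * c <= c * z by rewrite ler_wpM2l.
by rewrite expr2; lra.
Qed.

End shrinkage.

(** * Lower bound for the expected radial component of the noise *)

Section shrink_lower_bound.
Context d (T : measurableType d) (R : realType) (P : probability T R) (p : nat).
Variables (theta : 'rV[R]_p) (xi : T -> 'rV[R]_p) (sg : 'rV[R]_p -> T -> R).
Variables (s D kap : R).
Hypothesis mxi : forall i, measurable_fun setT (fun w => xi w 0 i).
Hypothesis xi2 : (\int[P]_w (norm2 (xi w) ^+ 2)%:E < +oo)%E.
Hypothesis msg : forall t, measurable_fun setT (sg t).
Hypothesis sg0 : forall t, t != 0 -> forall w, 0 < sg t w.
Hypothesis law : forall t, t != 0 -> forall B, measurable B ->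
  (P ((fun w => inner t (xi w)) @^-1` B) = \int[P]_w normal_prob 0 (sg t w) B)%E.
Hypothesis sg_ge : forall t, t != 0 -> {ae P, forall w, s * norm2 t <= sg t w}.
Hypothesis s0 : 0 <= s.
Hypothesis p1 : (1 <= p)%N.
Hypothesis D0 : 0 < D.
Hypothesis thetaD : norm2 theta <= D.
Hypothesis kap0 : 0 <= kap.
Hypothesis kapK : (kap%:E <=
  \int[gauss_tuple R p]_v ((D + s * norm2 (rowt R p v))^-1)%:E)%E.

(** All expectations are finite here, so the comparison [CMP], the Gaussian growth [GR] and the
    convexity bound [up] combine linearly into (1 - k) k c <= (1 - k) z. Dividing by 1 - k and
    letting k tend to 1 concludes. *)
Lemma shrink_lower_bound : (((p%:R - 1) * s ^+ 2 * kap)%:E <=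
  \int[P]_w (inner (xi w) (theta + xi w) / norm2 (theta + xi w))%:E)%E.
Proof.
set c := (p%:R - 1) * s ^+ 2 * kap.
have c0 : 0 <= c by rewrite !mulr_ge0 ?exprn_ge0 ?subr_ge0// ler1n.
have Zi := integrable_shrink _ _ _ P _ theta xi mxi xi2.
have fZ := integrable_fin_num measurableT Zi.
rewrite /= in fZ; rewrite -(fineK fZ) lee_fin; set z := fine _.
apply: le_of_forall_lt1 => // k k0 k1.
have k01 : 0 <= k <= 1 by rewrite !ltW.
have Aki := integrable_norm2_translate _ _ _ P _ theta xi mxi xi2 k k01.
have fAk := integrable_fin_num measurableT Aki; rewrite /= in fAk.
have fB t : (\int[gauss_tuple R p]_v (norm2 (theta + t *: rowt R p v))%:E)%E \is a fin_num.
  rewrite ge0_fin_numE ?integral_gauss_norm2_lty//.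
  by apply: integral_ge0 => v _; rewrite lee_fin norm2_ge0.
have CMP : (\int[P]_w (norm2 (theta + k *: xi w))%:E +
    \int[gauss_tuple R p]_v (norm2 (theta + s *: rowt R p v))%:E <=
    \int[P]_w (norm2 (theta + xi w))%:E +
    \int[gauss_tuple R p]_v (norm2 (theta + (k * s) *: rowt R p v))%:E)%E.
  exact: (norm2_mixture_comparison _ _ _ P _ theta xi sg s k).
have cc0 : 0 <= (1 - k) * s * (k * s) * (p%:R - 1).
  by rewrite !mulr_ge0 ?subr_ge0 ?(ltW k0) ?(ltW k1)// ler1n.
have GR : (\int[gauss_tuple R p]_v (norm2 (theta + (k * s) *: rowt R p v))%:E +
    ((1 - k) * s * (k * s) * (p%:R - 1))%:E * kap%:E <=
    \int[gauss_tuple R p]_v (norm2 (theta + s *: rowt R p v))%:E)%E.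
  apply: le_trans (gauss_norm2_growth _ _ theta s k D s0 k01 p1 D0 thetaD).
  by rewrite leeD2l// lee_wpmul2l// lee_fin.
have up : (\int[P]_w (norm2 (theta + xi w))%:E <=
    \int[P]_w (norm2 (theta + k *: xi w))%:E + (1 - k)%:E * z%:E + 0%:E)%E.
  have := @ge0_le_integral_nonmeasurable _ _ _ P
    (fun w => (norm2 (theta + xi w))%:E)
    (fun w => (norm2 (theta + k *: xi w) +
      (1 - k) * (inner (xi w) (theta + xi w) / norm2 (theta + xi w)) + 0)%:E).
  move=> /(_ (fun w => norm2_ge0 _ _ _) (fun w => norm2_le_shrink _ _ _ _ theta xi k w k01)).
  by rewrite (integral_affine_combination _ _ _ P _ _ _ _ Aki Zi) -(fineK fZ).
have fA : (\int[P]_w (norm2 (theta + xi w))%:E)%E \is a fin_num.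
  rewrite ge0_fin_numE; last by apply: integral_ge0 => w _; rewrite lee_fin norm2_ge0.
  by apply: le_lt_trans up _; rewrite -(fineK fAk) -EFinM -!EFinD ltry.
move: CMP GR up; rewrite -(fineK fA) -(fineK fAk) -(fineK (fB s)) -(fineK (fB (k * s))).
move: (fine _) (fine _) (fine _) (fine _) => x1 x2 x3 x4.
rewrite -!EFinM -!EFinD !lee_fin => CMP GR up.
have h : (1 - k) * (k * c) <= (1 - k) * z.
  have -> : (1 - k) * (k * c) = (1 - k) * s * (k * s) * (p%:R - 1) * kap.
    by rewrite /c; ring.
  by lra.
by rewrite -(@ler_pM2l _ (1 - k)) ?subr_gt0.
Qed.

End shrink_lower_bound.

(** * Assembly of the dominance bound *)

Lemma compact_norm2_le_sup (R : realType) p (Theta : set 'rV[R]_p) theta :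
  compact Theta -> Theta theta -> norm2 theta <= sup [set norm2 th | th in Theta].
Proof.
move=> cT Tt; apply: ub_le_sup; last by exists theta.
have [c cTh cmax] := @compact_EVT_max _ _ (fun v => inner v v) Theta (ex_intro _ _ Tt) cT
  (continuous_subspaceT (continuous_inner_self R p)).
exists (norm2 c) => _ [v Tv <-].
by rewrite -ler_sqr ?nnegrE ?norm2_ge0// !sqr_norm2; apply: cmax; rewrite inE.
Qed.

Lemma lambda_min_ge0 (R : realType) p (A : 'M[R]_p) :
  (0 < p)%N -> posdef A -> 0 <= lambda_min A.
Proof.
move=> p0 pA; have [symA _] := pA; have [l el _] := rayleigh_min _ _ A p0 symA.
apply: lb_le_inf; first by exists l.
by move=> a /= /(posdef_eigenvalue_gt0 _ _ A pA)/ltW.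
Qed.

Theorem theorem2p1 (R : realType) (p : nat) (dT : measure_display) (T : measurableType dT)
  (P : 'rV[R]_p -> probability T R)
  (G : set (set T)) (xi : T -> 'rV[R]_p) (D : T -> 'M[R]_p)
  (Theta : set 'rV[R]_p) (lam_star astar : R) :
  (2 <= p)%N ->
  (* G is a sub-sigma-algebra *)
  G `<=` measurable -> sigma_algebra setT G ->
  (* xi is a random vector *)
  (forall i : 'I_p, measurable_fun setT (fun w => xi w 0 i)) ->
  (* D is a G-measurable random positive definite covariance matrix *)
  (forall (i j : 'I_p) (B : set R), measurable B -> G ((fun w => D w i j) @^-1` B)) ->
  (forall w, posdef (D w)) ->
  (* Law(xi | G) = N_p(0, D) under every P_theta (Cramer-Wold form) *)
  (forall theta, Theta theta -> forall A, G A -> forall t : 'rV[R]_p, t != 0 ->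
     forall B : set R, measurable B ->
     P theta (A `&` [set w | B (inner t (xi w))]) =
     (\int[P theta]_(w in A) normal_prob 0 (Num.sqrt (qform (D w) t)) B)%E) ->
  compact Theta ->
  (* d = sup_{theta in Theta} ||theta|| > 0 *)
  0 < sup [set norm2 th | th in Theta] ->
  (* (i) *)
  0 < lam_star ->
  (forall theta, Theta theta -> {ae P theta, forall w, lam_star <= lambda_min (D w)}) ->
  (* (ii) *)
  0 < astar ->
  (forall theta, Theta theta ->
     (\int[P theta]_w (lambda_max (D w))%:E <= astar%:E)%E) ->
  let c := (p%:R - 1) * lam_star * gamma_const p (sup [set norm2 th | th in Theta]) astar in
  forall theta, Theta theta ->
    let Y := fun w => theta + xi w in
    let est := fun w => (1 - c / norm2 (Y w)) *: Y w in
    ((\int[P theta]_w ((norm2 (est w - theta)) ^+ 2)%:E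
      - \int[P theta]_w ((norm2 (Y w - theta)) ^+ 2)%:E)
     <= - (c ^+ 2)%:E)%E.
Proof.
move=> p2 Gm sG mxi GD pD law cTheta d0 lam0 lamD a0 lmaxa c theta Tt; cbv zeta.
set d := sup _ in d0 c *.
have p0 : (0 < p)%N by exact: ltn_trans p2.
(* Almost surely lam_star <= lambda_min <= lambda_max; taking expectations brings in [astar]. *)
have lamqa : lam_star <= astar.
  rewrite -lee_fin; apply: le_trans (lmaxa theta Tt); apply: ae_ge_integral.
  - exact: ltW.
  - move=> w; apply: le_trans (lambda_min_ge0 _ _ _ p0 (pD w)) _.
    exact: (lambda_min_le_max _ _ _ (pD w) p0).
  - apply: filterS (lamD theta Tt) => w /le_trans; apply.
    exact: (lambda_min_le_max _ _ _ (pD w) p0).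
pose s := Num.sqrt lam_star.
have s2 : s ^+ 2 = lam_star by rewrite sqr_sqrtr// ltW.
have s0 : 0 <= s by exact: sqrtr_ge0.
have sa : s <= Num.sqrt astar by rewrite ler_wsqrtr.
pose kap := gamma_const p d astar.
have kapE : (\int[gauss_tuple R p]_v ((d + Num.sqrt astar * norm2 (rowt R p v))^-1)%:E
    = kap%:E)%E.
  by rewrite /kap; case: (p) p0 => // q _; exact: gamma_constE.
have dpos t v : 0 <= t -> 0 < d + t * norm2 (rowt R p v).
  by move=> t0; rewrite ltr_pwDl// mulr_ge0 ?norm2_ge0.
have kap0 : 0 <= kap.
  rewrite -lee_fin -kapE; apply: integral_ge0 => v _.
  by rewrite lee_fin invr_ge0 ltW// dpos// sqrtr_ge0.
have kapK : (kap%:E <=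
    \int[gauss_tuple R p]_v ((d + s * norm2 (rowt R p v))^-1)%:E)%E.
  rewrite -kapE; apply: ge0_le_integral_nonmeasurable => v.
    by rewrite lee_fin invr_ge0 ltW// dpos// sqrtr_ge0.
  rewrite lee_fin lef_pV2 ?posrE ?dpos ?sqrtr_ge0//.
  by rewrite lerD2l ler_wpM2r ?norm2_ge0.
have cE : c = (p%:R - 1) * s ^+ 2 * kap by rewrite s2.
have c0 : 0 <= c.
  rewrite cE; apply: mulr_ge0 => //.
  by apply: mulr_ge0; [rewrite subr_ge0 ler1n|exact: sqr_ge0].
(* If the noise has infinite second moment, the risk of [Y] is +oo and the difference is -oo by the
   conventions of extended addition. *)
have [xi2|] := ltP (\int[P theta]_w (norm2 (xi w) ^+ 2)%:E)%E (+oo%E); last first.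
  rewrite leye_eq => /eqP xiy.
  have -> : (\int[P theta]_w (norm2 (theta + xi w - theta) ^+ 2)%:E = +oo)%E.
    by rewrite -xiy; apply: eq_integral => w _; rewrite addrAC subrr add0r.
  by rewrite addeNy leNye.
apply: shrink_risk => //; rewrite cE.
(* The conditional standard deviation of the projection <t, xi>. *)
pose sg (t : 'rV[R]_p) w := Num.sqrt (qform (D w) t).
have mD i j : measurable_fun setT (fun w => D w i j).
  by move=> _ B mB; rewrite setTI; apply: Gm; exact: GD.
have qpos t w : t != 0 -> 0 < qform (D w) t by have [_] := pD w; apply.
apply: (@shrink_lower_bound _ _ _ (P theta) _ theta xi sg s d kap) => //.
- move=> t; have ms : measurable_fun setT (@Num.sqrt R).
    exact: continuous_measurable_fun (@sqrt_continuous R).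
  apply: (measurableT_comp ms).
  rewrite (_ : (fun w => _) = fun w => \sum_i (\sum_k t 0 k * D w k i) * t 0 i).
    apply: measurable_sum => i; apply: measurable_funM => //.
    by apply: measurable_sum => k; exact: measurable_funM.
  by apply/funext => w; rewrite qform_inner; apply: eq_bigr => i _; rewrite mxE.
- by move=> t t0 w; rewrite sqrtr_gt0 qpos.
- move=> t t0 B mB.
  (* On the whole space the conditional law becomes a Gaussian variance mixture for each
     projection. *)
  have GT : G setT by case: sG => G0 GC _; rewrite -(setD0 setT); exact: GC.
  by have := law theta Tt setT GT t t0 B mB; rewrite setTI.
- move=> t t0; apply: filterS (lamD theta Tt) => w lw.
  rewrite -ler_sqr ?nnegrE ?sqrtr_ge0 ?mulr_ge0 ?norm2_ge0//.
  rewrite exprMn s2 sqr_norm2 sqr_sqrtr ?(ltW (qpos _ _ t0))//.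
  exact: (lambda_min_qform _ _ _ (pD w) p0).
- exact: compact_norm2_le_sup.
Qed.
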